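(* Let $\mathcal{A}(\mathcal{S})$ be a cluster algebra of rank $n$ and let $\Sigma_{t_l}=(\mathbf{x}_{t_l},\mathbf{y}_{t_l},B_{t_l})$, $l=1,2$, be two cluster seeds of the cluster pattern $\mathcal{S}$. Suppose there is a permutation $\sigma$ of $[1,n]$ with $x_{i;t_2}=x_{\sigma(i);t_1}$ for all $i\in[1,n]$. Then: (i) for each $k\in[1,n]$, either $y_{k;t_2}=y_{\sigma(k);t_1}$ and $b^{t_2}_{ik}=b^{t_1}_{\sigma(i)\sigma(k)}$ for all $i\in[1,n]$, or $y_{k;t_2}=y_{\sigma(k);t_1}^{-1}$ and $b^{t_2}_{ik}=-b^{t_1}_{\sigma(i)\sigma(k)}$ for all $i\in[1,n]$; (ii) in both cases $F_{k;t_2}=F_{\sigma(k);t_1}$ for all $k$, where each exchange polynomial $F_{j;t}$ is regarded as an element of $\mathcal{F}$ evaluated at the cluster $\mathbf{x}_t$.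
   Context: $\mathbb{P}$ is a semifield (an abelian multiplicative group with an auxiliary commutative, associative addition $\oplus$ over which multiplication distributes); its group ring $\mathbb{Z}\mathbb{P}$ is a domain, and $\mathcal{F}$ is the field of rational functions in $n$ independent variables over $\mathrm{Frac}(\mathbb{Z}\mathbb{P})$. An integer matrix $B=(b_{ij})$ is sign-skew-symmetric if for all $i,j$ either $b_{ij}b_{ji}<0$ or $b_{ij}=b_{ji}=0$; it is totally sign-skew-symmetric if every matrix obtained from it by a sequence of mutations (below) is sign-skew-symmetric. A cluster seed is a triple $(\mathbf{x},\mathbf{y},B)$ with $\mathbf{x}=\{x_1,\dots,x_n\}$ a transcendence basis of $\mathcal{F}$ over $\mathrm{Frac}(\mathbb{Z}\mathbb{P})$ (cluster variables), $\mathbf{y}=\{y_1,\dots,y_n\}\subset\mathbb{P}$ (coefficients), and $B$ an $n\times n$ totally sign-skew-symmetric integer matrix. Its exchange polynomials are $F_j=\frac{y_j}{1\oplus y_j}\prod_{b_{ij}>0}x_i^{b_{ij}}+\frac{1}{1\oplus y_j}\prod_{b_{ij}<0}x_i^{-b_{ij}}$. The mutation $\mu_k(\mathbf{x},\mathbf{y},B)=(\mathbf{x}',\mathbf{y}',B')$ is: $x'_k=F_k/x_k$, $x'_i=x_i$ ($i\ne k$); $y'_k=y_k^{-1}$, $y'_i=y_iy_k^{\max(b_{ki},0)}(1\oplus y_k)^{-b_{ki}}$ ($i\ne k$); $b'_{ij}=-b_{ij}$ if $i=k$ or $j=k$, and $b'_{ij}=b_{ij}+\mathrm{sgn}(b_{ik})\max(b_{ik}b_{kj},0)$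 otherwise. A cluster pattern $\mathcal{S}$ assigns a seed $(\mathbf{x}_t,\mathbf{y}_t,B_t)$, with $\mathbf{x}_t=\{x_{1;t},\dots\}$, $\mathbf{y}_t=\{y_{1;t},\dots\}$, $B_t=(b^t_{ij})$, exchange polynomials $F_{j;t}$, to each vertex $t$ of the $n$-regular tree $\mathbb{T}_n$ so that seeds joined by an edge labeled $k$ are related by $\mu_k$. The cluster algebra $\mathcal{A}(\mathcal{S})$ is the $\mathbb{Z}\mathbb{P}$-subalgebra of $\mathcal{F}$ generated by all cluster variables of $\mathcal{S}$. *)

(* Defs.v *)
From HB Require Import structures.
From mathcomp Require Import all_boot all_order all_algebra all_fingroup.
From mathcomp Require Import mpoly.
Set Implicit Arguments. Unset Strict Implicit. Unset Printing Implicit Defensive.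
Import Order.TTheory GRing.Theory Num.Theory.
Local Open Scope ring_scope.

Record semifield_ax (P : groupType) (oplus : P -> P -> P) : Prop := {
  sf_mulC : forall a b : P, (a * b = b * a)%g;
  sf_addC : forall a b : P, oplus a b = oplus b a;
  sf_addA : forall a b c : P, oplus a (oplus b c) = oplus (oplus a b) c;
  sf_mulDr : forall a b c : P, (a * oplus b c)%g = oplus (a * b)%g (a * c)%g
}.

Definition gexpz (P : groupType) (x : P) (z : int) : P :=
  match z with
  | Posz k => (x ^+ k)%g
  | Negz k => ((x ^+ k.+1)^-1)%g
  end.

(* The ambient field.  F is a field together with a map iota : P -> F  *)
(* which is a monoid morphism whose Z-linear extension ZP -> F is       *)
(* injective: this identifies the group ring ZP with a subring of F    *)
(* (so ZP is a domain) and Frac(ZP) with the subfield it generates.    *)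
Record group_ring_embedding (P : groupType) (F : fieldType) (iota : P -> F)
  : Prop := {
  gre1 : iota 1%g = 1;
  greM : forall a b : P, iota (a * b)%g = iota a * iota b;
  gre_indep : forall (m : nat) (p : 'I_m -> P) (c : 'I_m -> int),
      injective p -> \sum_(i < m) (c i)%:~R * iota (p i) = 0 ->
      forall i, c i = 0
}.

Section Ambient.
Variables (n : nat) (P : groupType) (F : fieldType) (iota : P -> F).

Definition in_ZP (f : F) : Prop :=
  exists (m : nat) (p : 'I_m -> P) (c : 'I_m -> int),
    f = \sum_(i < m) (c i)%:~R * iota (p i).

Definition ZP_mpoly (q : {mpoly F[n]}) : Prop := forall m, in_ZP q@_m.

Definition in_ZPx (x : 'I_n -> F) (a : F) : Prop :=
  exists q : {mpoly F[n]}, ZP_mpoly q /\ a = q.@[x].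

(* x_1..x_n algebraically independent over Frac(ZP)
   (denominators of coefficients cleared) *)
Definition alg_indep (x : 'I_n -> F) : Prop :=
  forall q : {mpoly F[n]}, ZP_mpoly q -> q.@[x] = 0 -> q = 0.

(* f algebraic over Frac(ZP)(x) (denominators cleared) *)
Definition algebraic_over_x (x : 'I_n -> F) (f : F) : Prop :=
  exists p : {poly F}, p != 0 /\ (forall i, in_ZPx x p`_i) /\ root p f.

Definition transcendence_basis (x : 'I_n -> F) : Prop :=
  alg_indep x /\ forall f : F, algebraic_over_x x f.

Definition rational_function_field : Prop :=
  exists z : 'I_n -> F, alg_indep z /\
    forall f : F, exists a b : F,
      [/\ in_ZPx z a, in_ZPx z b, b != 0 & f = a / b].

End Ambient.

Definition mutB (n : nat) (k : 'I_n) (B : 'M[int]_n) : 'M[int]_n :=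
  \matrix_(i, j) if (i == k) || (j == k) then - B i j
                 else B i j + sgz (B i k) * Num.max (B i k * B k j) 0.

Definition sign_skew_symmetric (n : nat) (B : 'M[int]_n) : Prop :=
  forall i j, B i j * B j i < 0 \/ (B i j = 0 /\ B j i = 0).

Definition totally_sign_skew_symmetric (n : nat) (B : 'M[int]_n) : Prop :=
  forall ks : seq 'I_n,
    sign_skew_symmetric (foldl (fun M k => mutB k M) B ks).

Record seed (n : nat) (P : groupType) (F : fieldType) := Seed {
  sx : 'I_n -> F;
  sy : 'I_n -> P;
  sB : 'M[int]_n
}.

Section Mutation.
Variables (n : nat) (P : groupType) (F : fieldType)
          (oplus : P -> P -> P) (iota : P -> F).

Definition exch (s : seed n P F) (j : 'I_n) : F :=
  iota (sy s j * (oplus 1 (sy s j))^-1)%g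
    * \prod_(i | 0 < sB s i j) sx s i ^+ absz (sB s i j)
  + iota ((oplus 1 (sy s j))^-1)%g
    * \prod_(i | sB s i j < 0) sx s i ^+ absz (sB s i j).

Definition mu (k : 'I_n) (s : seed n P F) : seed n P F :=
  Seed (fun i => if i == k then exch s k / sx s k else sx s i)
       (fun i => if i == k then ((sy s k)^-1)%g
                 else (sy s i * gexpz (sy s k) (Num.max (sB s k i) 0)
                         * gexpz (oplus 1 (sy s k)) (- sB s k i))%g)
       (mutB k (sB s)).

Definition cluster_seed (s : seed n P F) : Prop :=
  transcendence_basis iota (sx s) /\ totally_sign_skew_symmetric (sB s).

(* The n-regular tree T_n: vertices are reduced words over 'I_n (no two
   consecutive letters equal), rooted at [::]; the edges are exactly
   {w, rcons w k} labelled k, for rcons w k reduced. *)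
Definition reduced (w : seq 'I_n) : bool := sorted (fun a b => a != b) w.

Definition cluster_pattern (S : seq 'I_n -> seed n P F) : Prop :=
  (forall w, reduced w -> cluster_seed (S w)) /\
  (forall w k, reduced (rcons w k) -> S (rcons w k) = mu k (S w)).

End Mutation.

(* Main.v *)
(** Write the exchange polynomials as F_k.  If x_{t2} and x_{t1} agree up to
    sigma, then mutating t2 at k and t1 at sigma(k) gives two clusters that
    differ only in the variables F_{k;t2} / x and F_{sigma(k);t1} / x.  By the
    Laurent phenomenon each is a Laurent polynomial in the other cluster, so
    each of the two exchange polynomials divides the other up to a monomial;
    hence their quotient is a scalar times a monomial, and two binomials with
    this property have equal or opposite exponent vectors and coefficient
    ratios.  The vectors are both zero only for an isolated index; then x_k
    takes just two values along the whole pattern, which forces sigma(k) = k.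

    Consider first the Laurent phenomenon for a geometric pattern whose
    extended exchange matrix has independent columns.  A cluster variable is
    Laurent at the seeds mu_j(t) and mu_j mu_k mu_j(t) by induction on the
    distance, hence at t as soon as x_k' and x_j'' are not zero divisors modulo
    F_j; this is seen by comparing components for suitable gradings.  A pattern
    over an arbitrary semifield is reduced to principal coefficients by dividing
    the cluster variables by their values in the semifield. *)

Require Import Defs.
From HB Require Import structures.
From mathcomp Require Import all_boot all_order all_algebra all_fingroup.
From mathcomp Require Import mpoly ring zify.
From Stdlib Require Import FunctionalExtensionality.
Set Implicit Arguments. Unset Strict Implicit. Unset Printing Implicit Defensive.
Import Order.TTheory GRing.Theory Num.Theory.
Local Open Scope ring_scope.

(** * Graded ideals of polynomials *)

Section WeightComponents.
Variables (N : nat) (R : idomainType) (ell : 'I_N -> int).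
Implicit Types (p q f g a : {mpoly R[N]}) (m e : 'X_{1..N}) (t s : int).

Definition weight m : int := \sum_i ell i * (m i)%:Z.

Lemma weightD m e : weight (m + e)%MM = weight m + weight e.
Proof.
by rewrite /weight -big_split /=; apply: eq_bigr => i _; rewrite mnmDE PoszD mulrDr.
Qed.

Definition wcomp t p : {mpoly R[N]} :=
  \sum_(m <- msupp p | weight m == t) p@_m *: 'X_[m].

Lemma mcoeff_wcomp t p m : (wcomp t p)@_m = if weight m == t then p@_m else 0.
Proof.
rewrite /wcomp raddf_sum /=.
case: (boolP (m \in msupp p)) => [mp|mNp]; last first.
  rewrite (memN_msupp_eq0 mNp) if_same big_seq_cond big1 // => m' /andP[m'p _].
  have /negPf mm' : m' != m by apply: contraNneq mNp => <-.
  by rewrite mcoeffZ mcoeffX mm' mulr0.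
rewrite -big_filter.
case: ifPn => wm.
  rewrite (bigD1_seq m) ?mem_filter ?wm ?filter_uniq ?msupp_uniq //=.
  rewrite mcoeffZ mcoeffX eqxx mulr1 big1 ?addr0 // => m' /negPf m'm.
  by rewrite mcoeffZ mcoeffX m'm mulr0.
rewrite big_seq_cond big1 // => m'; rewrite mem_filter andbT => /andP[wm' _].
have /negPf mm' : m' != m by apply: contraNneq wm => <-.
by rewrite mcoeffZ mcoeffX mm' mulr0.
Qed.

Lemma wcompD t p q : wcomp t (p + q) = wcomp t p + wcomp t q.
Proof.
by apply/mpolyP => m; rewrite mcoeffD !mcoeff_wcomp mcoeffD; case: ifP; rewrite ?addr0.
Qed.

Lemma wcompZ t c p : wcomp t (c *: p) = c *: wcomp t p.
Proof.
by apply/mpolyP => m; rewrite mcoeffZ !mcoeff_wcomp mcoeffZ; case: ifP; rewrite ?mulr0.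
Qed.

Lemma wcomp0 t : wcomp t 0 = 0.
Proof. by apply/mpolyP => m; rewrite mcoeff_wcomp mcoeff0 if_same. Qed.

Lemma wcompX t m : wcomp t 'X_[m] = if weight m == t then 'X_[m] else 0.
Proof.
apply/mpolyP => m'; rewrite mcoeff_wcomp mcoeffX.
case: (m =P m') => [<-|/eqP mm']; first by case: ifP; rewrite ?mcoeffX ?eqxx ?mcoeff0.
by rewrite if_same; case: ifP; rewrite ?mcoeffX ?(negPf mm') ?mcoeff0.
Qed.

Lemma wcompMX t m p : wcomp t ('X_[m] * p) = 'X_[m] * wcomp (t - weight m) p.
Proof.
elim/mpolyind: p => [|c e p _ _ IH]; first by rewrite mulr0 !wcomp0 mulr0.
rewrite mulrDr !wcompD IH mulrDr; congr (_ + _).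
rewrite -scalerAr !wcompZ -scalerAr; congr (_ *: _).
by rewrite -mpolyXD !wcompX weightD addrC eq_sym -subr_eq eq_sym; case: ifP; rewrite ?mulr0 ?mpolyXD.
Qed.

Definition whomog s a := forall m, m \in msupp a -> weight m = s.

Lemma wcompM t s a p : whomog s a -> wcomp t (a * p) = a * wcomp (t - s) p.
Proof.
move=> ha; rewrite {1 2}(mpolyE a) !mulr_suml.
have -> : forall (r : seq 'X_{1..N}) (G : 'X_{1..N} -> {mpoly R[N]}),
    wcomp t (\sum_(m <- r) G m) = \sum_(m <- r) wcomp t (G m).
  by move=> r G; elim: r => [|m r IH]; rewrite ?big_nil ?wcomp0 // !big_cons wcompD IH.
rewrite [LHS]big_seq [RHS]big_seq; apply: eq_bigr => m /ha <-.
by rewrite -!scalerAl wcompZ wcompMX.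
Qed.

Lemma wcomp_sum p : p = \sum_(t <- undup (map weight (msupp p))) wcomp t p.
Proof.
apply/mpolyP => m; rewrite raddf_sum /=.
under eq_bigr do rewrite mcoeff_wcomp.
case: (boolP (m \in msupp p)) => [mp|mNp]; last first.
  by rewrite (memN_msupp_eq0 mNp) big1 // => t _; rewrite if_same.
rewrite (bigD1_seq (weight m)) ?undup_uniq ?mem_undup ?map_f //= eqxx big1 ?addr0 // => t.
by rewrite eq_sym => /negPf ->.
Qed.

(** Membership of [f] in the ideal generated by [a] in the Laurent polynomial ring, with
    denominators cleared. *)
Definition monomial_multiple a f := exists m w, 'X_[m] * f = a * w.

Lemma monomial_multipleD a f g :
  monomial_multiple a f -> monomial_multiple a g -> monomial_multiple a (f + g).
Proof.
move=> [m [w E]] [m' [w' E']]; exists (m + m')%MM, ('X_[m'] * w + 'X_[m] * w').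
rewrite mpolyXD mulrDr [_ * _ * f]mulrAC E -[_ * _ * g]mulrA E'; ring.
Qed.

Lemma monomial_multipleM a f g : monomial_multiple a f -> monomial_multiple a (g * f).
Proof. by move=> [m [w E]]; exists m, (g * w); rewrite mulrCA E; ring. Qed.

Lemma monomial_multiple_sum a (r : seq int) (G : int -> {mpoly R[N]}) :
  (forall t, monomial_multiple a (G t)) -> monomial_multiple a (\sum_(t <- r) G t).
Proof.
move=> H; apply: (big_ind (monomial_multiple a)) => //.
  by exists 0%MM, 0; rewrite !mulr0.
exact: monomial_multipleD.
Qed.

(* The ideal of Laurent multiples of [a] is graded, and ['X_[e] + g] has two
   components of different weights, one of which is invertible: comparing
   components shows one by one that those of [f] lie in the ideal. *)
Lemma whomog_regular s r a g e f :
  whomog s a -> whomog r g -> weight e != r ->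
  monomial_multiple a (('X_[e] + g) * f) -> monomial_multiple a f.
Proof.
move=> ha hg er [m [w E]].
have I1 t : monomial_multiple a (wcomp t (('X_[e] + g) * f)).
  exists m, (wcomp (t + weight m - s) w).
  by rewrite -wcompM // -E wcompMX addrK.
(* Each weight component of the product mixes just two components of [f], whose weights differ by
   [d]; the one multiplied by ['X_[e]] can be isolated. *)
set d := weight e - r.
have I2 t : monomial_multiple a ('X_[e] * wcomp t f + g * wcomp (t + d) f).
  have := I1 (t + weight e); rewrite mulrDl wcompD wcompMX (wcompM _ _ hg) addrK.
  by rewrite /d addrA.
have step t : monomial_multiple a (wcomp (t + d) f) -> monomial_multiple a (wcomp t f).
  move=> H; have [m1 [w1]] : monomial_multiple a ('X_[e] * wcomp t f).
    have := monomial_multipleD (I2 t) (monomial_multipleM (- g) H).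
    by rewrite mulNr addrK.
  by rewrite mulrA -mpolyXD => E1; exists (m1 + e)%MM, w1.
(* All weights occurring in [f] lie between [-b] and [b]; the vanishing components outside this
   range start the descent. *)
pose b := \sum_(m0 <- msupp f) `|weight m0|%N.
have far t : (b < `|t|)%N -> monomial_multiple a (wcomp t f).
  move=> bt; suff -> : wcomp t f = 0 by exists 0%MM, 0; rewrite !mulr0.
  rewrite /wcomp big_seq_cond big_pred0 // => m0.
  apply: contraTF bt => /andP[m0f /eqP <-]; rewrite -leqNgt /b.
  by rewrite (bigD1_seq m0) ?msupp_uniq //= leq_addr.
have d0 : d != 0 by rewrite subr_eq0.
(* While [t] stays in that range, adding [d] strictly decreases the nonnegative number
   [b - sgz d * t], so finitely many moves leave the range. *)
have all k t : `|b%:Z - sgz d * t| <= k%:Z -> monomial_multiple a (wcomp t f).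
  elim: k t => [|k IH] t Hk.
    apply: step; apply: far; move: d0 Hk.
    by case: (ltrgtP d 0) => [dn|dp|->] // _; rewrite ?(ltr0_sgz dn) ?(gtr0_sgz dp); lia.
  case: (leqP (absz t) b) => tb; last exact: far.
  have [tb'|tb'] := leqP (absz (t + d)) b; last by apply: step; apply: far.
  apply: step; apply: IH; move: d0 Hk.
  by case: (ltrgtP d 0) => [dn|dp|->] // _; rewrite ?(ltr0_sgz dn) ?(gtr0_sgz dp); lia.
rewrite (wcomp_sum f); apply: monomial_multiple_sum => t.
by apply: (all (absz (b%:Z - sgz d * t)%R) t); rewrite abszE.
Qed.

Lemma whomogX m : whomog (weight m) 'X_[m].
Proof. by move=> m'; rewrite msuppX mem_seq1 => /eqP ->. Qed.

Lemma whomogD s a f : whomog s a -> whomog s f -> whomog s (a + f).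
Proof. by move=> ha hf m /msuppD_le; rewrite mem_cat => /orP[/ha|/hf]. Qed.

Lemma whomogMn s a k : whomog s a -> whomog s (a *+ k).
Proof.
move=> ha; elim: k => [|k IH]; first by move=> m; rewrite mulr0n msupp0.
by rewrite mulrS; apply: whomogD.
Qed.

End WeightComponents.

(** * Exchange patterns of geometric type *)

Section Evaluation.
Variable N : nat.
Implicit Types (p q : {mpoly int[N]}) (m : 'X_{1..N}).

Definition ev (E : fieldType) (x : 'I_N -> E) q : E := mmap intr x q.

Lemma evD (E : fieldType) (x : 'I_N -> E) p q : ev x (p + q) = ev x p + ev x q.
Proof. exact: mmapD. Qed.

Lemma evM (E : fieldType) (x : 'I_N -> E) p q : ev x (p * q) = ev x p * ev x q.
Proof. exact: rmorphM. Qed.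

Lemma evX (E : fieldType) (x : 'I_N -> E) m : ev x 'X_[m] = \prod_i x i ^+ m i.
Proof. by rewrite /ev mmapX /mmap1. Qed.

Lemma evC (E : fieldType) (x : 'I_N -> E) (c : int) : ev x c%:MP = c%:~R.
Proof. exact: mmapC. Qed.

Lemma evX_neq0 (E : fieldType) (x : 'I_N -> E) m :
  (forall i, x i != 0) -> ev x 'X_[m] != 0.
Proof. by move=> x0; rewrite evX; apply/prodf_neq0 => i _; rewrite expf_neq0. Qed.

(* The generic point: an identity of integer polynomials holds as soon as it
   holds there, and it avoids all zeros of subtraction-free expressions. *)
Definition indeterminates (i : 'I_N) : {fraction {mpoly int[N]}} := tofrac 'X_i.

Lemma ev_indeterminates q : ev indeterminates q = tofrac q.
Proof.
elim/mpolyind: q => [|c m q _ _ IH]; first by rewrite /ev mmap0 tofrac0.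
rewrite evD IH tofracD; congr (_ + _).
rewrite -mul_mpolyC evM evC tofracM evX; congr (_ * _).
  by rewrite -[c in c%:MP]intz (rmorph_int (@mpolyC N int)) (rmorph_int (@tofrac _)).
rewrite mpolyXE_id rmorph_prod /=; apply: eq_bigr => i _.
by rewrite tofracXn.
Qed.

Definition nneg_mpoly p := p != 0 /\ forall m, 0 <= p@_m.

Lemma nneg_mpolyD p q : nneg_mpoly p -> nneg_mpoly q -> nneg_mpoly (p + q).
Proof.
move=> [p0 pge] [q0 qge]; split; last by move=> m; rewrite mcoeffD addr_ge0.
apply: contraNneq p0 => pq; apply/eqP/mpolyP => m; rewrite mcoeff0; apply/eqP.
have /eqP := congr1 (mcoeff m) pq.
by rewrite mcoeffD mcoeff0 paddr_eq0 // => /andP[].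
Qed.

Lemma nneg_mpolyM p q : nneg_mpoly p -> nneg_mpoly q -> nneg_mpoly (p * q).
Proof.
move=> [p0 pge] [q0 qge]; split; first by rewrite mulf_neq0.
by move=> m; rewrite mcoeffM sumr_ge0 // => k _; rewrite mulr_ge0.
Qed.

(** Zero is excluded, while sums, products and inverses stay inside: exchange relations starting
    from the indeterminates never produce zero. *)
Definition subtraction_free (f : {fraction {mpoly int[N]}}) :=
  exists p q, [/\ nneg_mpoly p, nneg_mpoly q & f = tofrac p / tofrac q].

Lemma subtraction_free_neq0 f : subtraction_free f -> f != 0.
Proof.
by move=> [p [q [[p0 _] [q0 _] ->]]]; rewrite mulf_neq0 ?invr_neq0 // tofrac_eq0.
Qed.

Lemma subtraction_freeD f g :
  subtraction_free f -> subtraction_free g -> subtraction_free (f + g).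
Proof.
move=> [p [q [hp hq ->]]] [p' [q' [hp' hq' ->]]].
exists (p * q' + p' * q), (q * q').
have [[q0 _] [q'0 _]] := (hq, hq').
split; [by apply: nneg_mpolyD; apply: nneg_mpolyM | exact: nneg_mpolyM |].
by rewrite tofracD !tofracM addf_div ?tofrac_eq0.
Qed.

Lemma subtraction_freeM f g :
  subtraction_free f -> subtraction_free g -> subtraction_free (f * g).
Proof.
move=> [p [q [hp hq ->]]] [p' [q' [hp' hq' ->]]]; exists (p * p'), (q * q').
by split; [exact: nneg_mpolyM | exact: nneg_mpolyM | rewrite !tofracM mulf_div].
Qed.

Lemma subtraction_freeV f : subtraction_free f -> subtraction_free f^-1.
Proof. by move=> [p [q [hp hq ->]]]; exists q, p; split=> //; rewrite invf_div. Qed.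

Lemma nneg_mpolyX m : nneg_mpoly 'X_[m].
Proof.
split; first by rewrite -msupp_eq0 msuppX.
by move=> m'; rewrite mcoeffX ler0n.
Qed.

Lemma subtraction_free1 : subtraction_free 1.
Proof.
by exists 'X_[0], 'X_[0]; split; rewrite ?divff ?mpolyX0 ?tofrac1 ?oner_eq0 //;
   rewrite -mpolyX0; apply: nneg_mpolyX.
Qed.

Lemma subtraction_free_prod (g : 'I_N -> {fraction {mpoly int[N]}}) (e : 'I_N -> nat) :
  (forall i, subtraction_free (g i)) -> subtraction_free (\prod_i g i ^+ e i).
Proof.
move=> hg; apply: (big_ind subtraction_free) => // [||i _].
- exact: subtraction_free1.
- exact: subtraction_freeM.
elim: (e i) => [|k IH]; first by rewrite expr0; apply: subtraction_free1.
by rewrite exprS; apply: subtraction_freeM.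
Qed.

Lemma subtraction_free_indeterminates i : subtraction_free (indeterminates i).
Proof.
exists 'X_i, 1; split; [exact: nneg_mpolyX | | by rewrite tofrac1 divr1].
by rewrite -mpolyX0; apply: nneg_mpolyX.
Qed.

End Evaluation.

(* The part [max (z, 0)] (for [s = true]) or [max (- z, 0)] of an exponent. *)
Definition signed_part (s : bool) (z : int) : nat :=
  absz (Num.max (if s then z else - z) 0).

(** * Mutation of extended matrices and of points; Laurent functions *)

Section GeometricPattern.
Variables (n m : nat).
Let N := (n + m)%N.
Implicit Types (B : 'M[int]_(N, n)) (k j : 'I_n) (ks : seq 'I_n).

(* Rows [lshift m k] of [B] are the mutable ones, rows [rshift n i] the frozen ones. *)
Definition emut k B : 'M[int]_(N, n) :=
  \matrix_(i, j) if (i == lshift m k) || (j == k) then - B i j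
                 else B i j + sgz (B i k) * Num.max (B i k * B (lshift m k) j) 0.

Definition emon (E : fieldType) B (s : bool) k (x : 'I_N -> E) : E :=
  \prod_i x i ^+ signed_part s (B i k).

Definition eexch (E : fieldType) B k (x : 'I_N -> E) : E :=
  emon B true k x + emon B false k x.

Definition emu (E : fieldType) B k (x : 'I_N -> E) (i : 'I_N) : E :=
  if i == lshift m k then eexch B k x / x i else x i.

(** Clusters are values at a point of a field rather than rational functions; points where a
    division by zero would occur are excluded by [nonvanishing]. *)
Fixpoint cvars (E : fieldType) B (x : 'I_N -> E) ks : 'I_N -> E :=
  if ks is k :: ks' then cvars (emut k B) (emu B k x) ks' else x.

Definition nonvanishing (E : fieldType) B (x : 'I_N -> E) :=
  forall ks i, cvars B x ks i != 0.

Lemma nonvanishing_neq0 (E : fieldType) B (x : 'I_N -> E) i :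
  nonvanishing B x -> x i != 0.
Proof. by move=> H; apply: (H [::] i). Qed.

Lemma nonvanishing_emu (E : fieldType) B (x : 'I_N -> E) k :
  nonvanishing B x -> nonvanishing (emut k B) (emu B k x).
Proof. by move=> H ks i; apply: (H (k :: ks) i). Qed.

(** Every cluster variable is a subtraction-free expression in the initial ones. *)
Lemma nonvanishing_indeterminates B : nonvanishing B (@indeterminates N).
Proof.
suff H ks C x : (forall i, @subtraction_free N (x i)) ->
    forall i, subtraction_free (cvars C x ks i).
  move=> ks i; apply/subtraction_free_neq0/H => {}i.
  exact: subtraction_free_indeterminates.
elim: ks C x => [|k ks IH] C x hx //= ; apply: IH => i.
rewrite /emu; case: ifP => // _; apply: subtraction_freeM; last exact: subtraction_freeV.
by apply: subtraction_freeD; apply: subtraction_free_prod.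
Qed.

(** The generic point is an admissible test point, and evaluation there is the embedding into the
    field of fractions. *)
Lemma ev_inj B (p q : {mpoly int[N]}) :
  (forall (E : fieldType) (x : 'I_N -> E), nonvanishing B x -> ev x p = ev x q) -> p = q.
Proof.
move=> /(_ _ _ (nonvanishing_indeterminates B)).
by rewrite !ev_indeterminates => /eqP; rewrite tofrac_eq => /eqP.
Qed.

(* Cluster variables are treated as partial rational maps, given by their values
   at all points of all fields; [laurent] asks for a single integer Laurent
   polynomial valid at every point where the whole pattern is defined. *)
Definition field_map := forall E : fieldType, ('I_N -> E) -> E.

Definition laurent B (f : field_map) :=
  exists (q : {mpoly int[N]}) (d : 'X_{1..N}), forall (E : fieldType) (x : 'I_N -> E),
    nonvanishing B x -> f E x * ev x 'X_[d] = ev x q.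

Lemma eq_laurent B (f g : field_map) :
  (forall (E : fieldType) (x : 'I_N -> E), nonvanishing B x -> f E x = g E x) ->
  laurent B f -> laurent B g.
Proof. by move=> fg [q [d H]]; exists q, d => E x nv; rewrite -fg ?H. Qed.

Lemma laurent_ev B q : laurent B (fun E x => ev x q).
Proof. by exists q, 0%MM => E x _; rewrite mpolyX0 /ev rmorph1 mulr1. Qed.

Lemma laurentD B (f g : field_map) :
  laurent B f -> laurent B g -> laurent B (fun E x => f E x + g E x).
Proof.
move=> [q [d H]] [q' [d' H']]; exists (q * 'X_[d'] + q' * 'X_[d]), (d + d')%MM.
by move=> E x nv; rewrite evD mpolyXD !evM -H // -H' //; ring.
Qed.

Lemma laurentM B (f g : field_map) :
  laurent B f -> laurent B g -> laurent B (fun E x => f E x * g E x).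
Proof.
move=> [q [d H]] [q' [d' H']]; exists (q * q'), (d + d')%MM.
by move=> E x nv; rewrite mpolyXD !evM -H // -H' //; ring.
Qed.

Lemma laurent_int B (c : int) : laurent B (fun E x => c%:~R).
Proof. by apply: eq_laurent (laurent_ev B c%:MP) => E x _; rewrite evC. Qed.

Lemma laurentN B (f : field_map) : laurent B f -> laurent B (fun E x => - f E x).
Proof.
move=> Lf; apply: eq_laurent (laurentM (laurent_int B (-1)) Lf) => E x _.
by rewrite mulrN1z mulN1r.
Qed.

Lemma laurent_var B i : laurent B (fun E x => x i).
Proof.
apply: eq_laurent (laurent_ev B 'X_i) => E x _.
by rewrite /ev mmapX mmap1U.
Qed.

Lemma laurent_varV B i : laurent B (fun E x => (x i)^-1).
Proof.
exists 1, U_(i)%MM => E x nv; rewrite /ev mmapX mmap1U rmorph1 mulVf //.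
exact: nonvanishing_neq0 nv.
Qed.

Lemma laurentXn B (f : field_map) (k : nat) :
  laurent B f -> laurent B (fun E x => f E x ^+ k).
Proof.
move=> Lf; elim: k => [|k IH].
  by apply: eq_laurent (laurent_int B 1) => E x _; rewrite expr0.
by apply: eq_laurent (laurentM Lf IH) => E x _; rewrite exprS.
Qed.

Lemma laurent_prod B (I : Type) (r : seq I) (P : pred I) (f : I -> field_map) :
  (forall i, P i -> laurent B (f i)) ->
  laurent B (fun E x => \prod_(i <- r | P i) f i E x).
Proof.
move=> Lf; elim: r => [|i r IH].
  by apply: eq_laurent (laurent_int B 1) => E x _; rewrite big_nil.
case: (boolP (P i)) => Pi.
  by apply: eq_laurent (laurentM (Lf i Pi) IH) => E x _; rewrite big_cons Pi.
by apply: eq_laurent IH => E x _; rewrite big_cons (negPf Pi).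
Qed.

Lemma laurent_comp B (y : 'I_N -> field_map) (q : {mpoly int[N]}) :
  (forall i, laurent B (y i)) -> laurent B (fun E x => ev (fun i => y i E x) q).
Proof.
move=> Ly; elim/mpolyind: q => [|c e q _ _ IH] /=.
  by apply: eq_laurent (laurent_int B 0) => E x _; rewrite /ev mmap0.
have Le : laurent B (fun E x => c%:~R * \prod_i y i E x ^+ e i).
  apply: (laurentM (laurent_int B c)).
  by apply: (@laurent_prod _ _ _ _ (fun i E x => y i E x ^+ e i)) => i _; apply: laurentXn.
by apply: eq_laurent (laurentD Le IH) => E x _; rewrite evD -mul_mpolyC evM evC evX.
Qed.

End GeometricPattern.

(** * Regular elements modulo an exchange polynomial *)

Section SignedPart.
Implicit Types (s : bool) (z a b : int).

Lemma signed_partN s z : signed_part s (- z) = signed_part (~~ s) z.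
Proof. by case: s; rewrite /signed_part /= ?opprK. Qed.

Lemma signed_part0 s : signed_part s 0 = 0%N.
Proof. by case: s. Qed.

Lemma signed_part_sub s z :
  (signed_part s z)%:Z - (signed_part (~~ s) z)%:Z = if s then z else - z.
Proof. by rewrite /signed_part; case: s => /=; lia. Qed.

Lemma signed_part_eq0 s z : (if s then z <= 0 else 0 <= z) -> signed_part s z = 0%N.
Proof. by rewrite /signed_part; case: s => /=; lia. Qed.

(* The signed correction term of the matrix mutation rule, in its symmetric form. *)
Lemma mutation_termE a b :
  sgz a * Num.max (a * b) 0 =
    (signed_part true a * signed_part true b)%:Z
    - (signed_part false a * signed_part false b)%:Z.
Proof.
have E s z : (signed_part s z)%:Z = Num.max (if s then z else - z) 0.
  by rewrite /signed_part; case: s; lia.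
rewrite !PoszM !E /=.
have max_pos z : 0 <= z -> Num.max z 0 = z by lia.
have max_neg z : z <= 0 -> Num.max z 0 = 0 by lia.
have [an|[->|ap]] : a < 0 \/ a = 0 \/ 0 < a by lia.
- rewrite ltr0_sgz // (max_neg a) ?ltW // (max_pos (- a)); last by lia.
  have [hb|hb] : 0 <= b \/ b <= 0 by lia.
    by rewrite (max_neg (a * b)) ?(max_neg (- b)); [ring|lia|nia].
  by rewrite (max_pos (a * b)) ?(max_pos (- b)); [ring|lia|nia].
- by rewrite sgz0 oppr0 maxxx; ring.
rewrite gtr0_sgz // (max_pos a) ?ltW // (max_neg (- a)); last by lia.
have [hb|hb] : 0 <= b \/ b <= 0 by lia.
  by rewrite (max_pos (a * b)) ?(max_pos b); [ring|lia|nia].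
by rewrite (max_neg (a * b)) ?(max_neg b); [ring|lia|nia].
Qed.

Lemma mutation_term_sign s a b : (if s then 0 <= b else b <= 0) ->
  sgz a * Num.max (a * b) 0 =
    (if s then 1 else -1) * (signed_part s a * signed_part s b)%:Z.
Proof.
rewrite mutation_termE; case: s => hb.
  by rewrite (@signed_part_eq0 false b) // muln0 subr0 mul1r.
by rewrite (@signed_part_eq0 true b) // muln0 sub0r mulN1r.
Qed.

End SignedPart.

(** * Monomials with exponents given by functions *)

Section Monomials.
Variable N : nat.
Implicit Types (v w : 'I_N -> nat) (j : 'I_N).

Definition mon (E : fieldType) (x : 'I_N -> E) v : E := \prod_i x i ^+ v i.

Definition mvec v : 'X_{1..N} := [multinom v i | i < N].

Definition off j v : 'I_N -> nat := fun i => if i == j then 0%N else v i.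

Lemma ev_mvec (E : fieldType) (x : 'I_N -> E) v : ev x 'X_[mvec v] = mon x v.
Proof. by rewrite evX; apply: eq_bigr => i _; rewrite mnmE. Qed.

Lemma monD (E : fieldType) (x : 'I_N -> E) v w :
  mon x v * mon x w = mon x (fun i => v i + w i)%N.
Proof. by rewrite -big_split /=; apply: eq_bigr => i _; rewrite exprD. Qed.

Lemma monXn (E : fieldType) (x : 'I_N -> E) v r :
  mon x v ^+ r = mon x (fun i => r * v i)%N.
Proof. by rewrite -prodrXl; apply: eq_bigr => i _; rewrite mulnC exprM. Qed.

Lemma eq_mon (E : fieldType) (x : 'I_N -> E) v w : v =1 w -> mon x v = mon x w.
Proof. by move=> vw; apply: eq_bigr => i _; rewrite vw. Qed.

Lemma mon_off (E : fieldType) (x y : 'I_N -> E) j v :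
  (forall i, i != j -> y i = x i) -> mon y v = y j ^+ v j * mon x (off j v).
Proof.
move=> yx; rewrite /mon (bigD1 j) //= [in RHS](bigD1 j) //= /off eqxx expr0 mul1r.
by congr (_ * _); apply: eq_bigr => i ij; rewrite (negPf ij) yx.
Qed.

Lemma mon_neq0 (E : fieldType) (x : 'I_N -> E) v :
  (forall i, x i != 0) -> mon x v != 0.
Proof. by move=> x0; apply/prodf_neq0 => i _; rewrite expf_neq0. Qed.

Lemma weight_delta j v : weight (fun i => (i == j)%:Z) (mvec v) = (v j)%:Z.
Proof.
rewrite /weight (bigD1 j) //= eqxx mul1r mnmE big1 ?addr0 // => i /negPf ->.
by rewrite mul0r.
Qed.

End Monomials.

(** * Divisibility and non-zero-divisors in the Laurent ring *)

Section Regularity.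
Variables (n m : nat).
Let N := (n + m)%N.
Implicit Types (B : 'M[int]_(N, n)) (f g h a u : @field_map n m).

Lemma laurent_mon B v : laurent B (fun E x => mon x v).
Proof. by apply: eq_laurent (laurent_ev B 'X_[mvec v]) => E x _; rewrite ev_mvec. Qed.

Lemma laurent_monV B v : laurent B (fun E x => (mon x v)^-1).
Proof.
have L : laurent B (fun E x => \prod_i (x i)^-1 ^+ v i).
  apply: (@laurent_prod _ _ _ _ _ _ (fun i E x => (x i)^-1 ^+ v i)) => i _.
  exact: (laurentXn _ (laurent_varV B i)).
apply: eq_laurent L => E x _.
by rewrite /mon -prodfV; apply: eq_bigr => i _; rewrite exprVn.
Qed.

Definition laurent_dvd B a g :=
  exists2 w, laurent B w &
    forall (E : fieldType) (x : 'I_N -> E), nonvanishing B x -> g E x = a E x * w E x.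

(** Says that [h] is not a zero divisor in the Laurent ring modulo [a]. *)
Definition regular_mod B a h := forall g,
  laurent B g -> laurent_dvd B a (fun E x => h E x * g E x) -> laurent_dvd B a g.

Lemma regular_modM B a g h : laurent B h ->
  regular_mod B a g -> regular_mod B a h ->
  regular_mod B a (fun E x => g E x * h E x).
Proof.
move=> Lh rg rh f Lf [w Lw H]; apply: rh => //; apply: rg; first exact: laurentM Lh Lf.
by exists w => // E x nv; rewrite mulrA H.
Qed.

Lemma regular_modXn B a h (k : nat) : laurent B h ->
  regular_mod B a h -> regular_mod B a (fun E x => h E x ^+ k).
Proof.
move=> Lh rh; elim: k => [|k IH] f Lf [w Lw H].
  by exists w => // E x nv; rewrite -H // expr0 mul1r.
apply: IH => //; apply: rh; first exact: laurentM (laurentXn k Lh) Lf.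
by exists w => // E x nv; rewrite mulrA -exprS H.
Qed.

Lemma regular_mod_unit B a u (u' : @field_map n m) : laurent B u' ->
  (forall (E : fieldType) (x : 'I_N -> E), nonvanishing B x -> u' E x * u E x = 1) ->
  regular_mod B a u.
Proof.
move=> Lu' uu' f Lf [w Lw H]; exists (fun E x => u' E x * w E x).
  exact: laurentM.
by move=> E x nv; rewrite mulrCA -H // mulrA uu' // mul1r.
Qed.

(** Modulo [a], multiplying by [h'] and then by [u] is multiplying by [h], so whatever [h'] kills is
    killed by [h]. *)
Lemma regular_mod_congr B a h h' u l : laurent B u -> laurent B l ->
  (forall (E : fieldType) (x : 'I_N -> E), nonvanishing B x ->
     h' E x * u E x = h E x + a E x * l E x) ->
  regular_mod B a h -> regular_mod B a h'.
Proof.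
move=> Lu Ll hh' rh g Lg [w Lw H]; apply: rh => //.
exists (fun E x => u E x * w E x - l E x * g E x).
  exact: (laurentD (laurentM Lu Lw) (laurentN (laurentM Ll Lg))).
move=> E x nv; have -> : h E x = h' E x * u E x - a E x * l E x by rewrite hh' // addrK.
transitivity (u E x * (h' E x * g E x) - a E x * l E x * g E x); first by ring.
by rewrite H //; ring.
Qed.

(** Carries [whomog_regular] over to Laurent functions: monomials clear the denominators, and
    [ev_inj] turns pointwise identities into polynomial ones. *)
Lemma regular_mod_weights B (ell : 'I_N -> int) s r (A G : {mpoly int[N]}) e :
  whomog ell s A -> whomog ell r G -> weight ell e != r ->
  regular_mod B (fun E x => ev x A) (fun E x => ev x ('X_[e] + G)).
Proof.
move=> hA hG er g [q [d Hq]] [w [p [d' Hp]] H].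
have [|c [w' Hw']] := @whomog_regular _ _ ell s r A G e q hA hG er.
  exists d', ('X_[d] * p); apply: (@ev_inj n m B) => E x nv.
  rewrite !evM -Hq // -Hp //; transitivity (ev x ('X_[e] + G) * g E x * ev x 'X_[d] * ev x 'X_[d']).
    by ring.
  by rewrite H //; ring.
exists (fun E x => ev x w' * (ev x 'X_[c + d])^-1).
  apply: laurentM (laurent_ev _ _) _; apply: eq_laurent (laurent_monV B (c + d)%MM) => E x _.
  by rewrite evX.
move=> E x nv.
have x0 i : x i != 0 by apply: nonvanishing_neq0 nv.
have := congr1 (ev x) Hw'; rewrite !evM -Hq // => {}Hw'.
rewrite mulrA -Hw' mpolyXD evM; field.
by rewrite !evX_neq0.
Qed.

(* [f] is Laurent away from [a = 0] and away from [h = 0], hence Laurent, since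
   [h] is not a zero divisor modulo [a]. *)
Lemma laurent_descent B f a h (k : nat) : laurent B a ->
  (forall (E : fieldType) (x : 'I_N -> E), nonvanishing B x -> a E x != 0) ->
  regular_mod B a h -> laurent B (fun E x => f E x * h E x) ->
  laurent B (fun E x => f E x * a E x ^+ k) -> laurent B f.
Proof.
move=> La a0 rh Lfh; elim: k => [|k IH] Lk.
  by apply: eq_laurent Lk => E x _; rewrite expr0 mulr1.
have [|w Lw H] := rh _ Lk.
  exists (fun E x => a E x ^+ k * (f E x * h E x)); first exact: laurentM (laurentXn k La) Lfh.
  by move=> E x _; rewrite exprS; ring.
apply: IH; apply: eq_laurent Lw => E x nv.
by apply: (mulfI (a0 E x nv)); rewrite -H // exprS; ring.
Qed.

(** Binomial expansion to first order in [g], with a Laurent remainder [T]. For [r = 0] the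
    truncated exponent [r.-1] is harmless, since the linear term is then taken zero times. *)
Lemma laurent_exprD B f g (r : nat) : laurent B f -> laurent B g ->
  exists2 T, laurent B T & forall (E : fieldType) (x : 'I_N -> E),
    (f E x + g E x) ^+ r = f E x ^+ r + (f E x ^+ r.-1 * g E x) *+ r + g E x ^+ 2 * T E x.
Proof.
move=> Lf Lg; elim: r => [|r [T LT HT]] /=.
  by exists (fun E x => 0%:~R); [exact: laurent_int | move=> E x; rewrite !expr0 mulr0n mulr0 !addr0].
exists (fun E x => (f E x + g E x) * T E x + f E x ^+ r.-1 * r%:~R).
  exact: laurentD (laurentM (laurentD Lf Lg) LT) (laurentM (laurentXn _ Lf) (laurent_int B r)).
move=> E x; rewrite exprS HT /= -pmulrn; move: (f E x) (g E x) (T E x) => a b t.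
case: r {HT} => [|r] /=; first by rewrite mulr0n mulr1n; ring.
by rewrite -(mulr_natr (_ ^+ r * _)) -(mulr_natr (_ ^+ r.+1 * _)) !exprS; ring.
Qed.

End Regularity.

(** * Three consecutive mutations *)

Section ExtendedMatrices.
Variables (n m : nat).
Let N := (n + m)%N.
Implicit Types (B : 'M[int]_(N, n)) (j k : 'I_n).

(** Independence of the columns supplies the gradings that separate exchange polynomials, and it
    survives mutation. *)
Record good_matrix B : Prop := {
  good_indep : forall w : 'I_n -> int,
    (forall i, \sum_j B i j * w j = 0) -> forall j, w j = 0;
  good_tsss : totally_sign_skew_symmetric (usubmx B)
}.

Lemma lshift_eq j k : (lshift m j == lshift m k) = (j == k).
Proof. exact: (inj_eq (@lshift_inj _ _)). Qed.

Lemma usubmx_emut k B : usubmx (emut k B) = mutB k (usubmx B).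
Proof. by apply/matrixP => i j; rewrite !mxE lshift_eq. Qed.

Lemma good_sign B : good_matrix B -> forall j k,
  B (lshift m j) k * B (lshift m k) j < 0 \/
  (B (lshift m j) k = 0 /\ B (lshift m k) j = 0).
Proof. by move=> gB j k; have := good_tsss gB [::] j k; rewrite /= !mxE. Qed.

Lemma good_diag B k : good_matrix B -> B (lshift m k) k = 0.
Proof. by move=> gB; case: (good_sign gB k k) => [|[]//]; nia. Qed.

Lemma emut_row k B j : emut k B (lshift m k) j = - B (lshift m k) j.
Proof. by rewrite mxE eqxx. Qed.

Lemma emut_col k B i : emut k B i k = - B i k.
Proof. by rewrite mxE eqxx orbT. Qed.

Lemma emutE k B i j : i != lshift m k -> j != k ->
  emut k B i j = B i j + sgz (B i k) * Num.max (B i k * B (lshift m k) j) 0.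
Proof. by move=> /negPf ik /negPf jk; rewrite mxE ik jk. Qed.

Lemma emutK k B : emut k (emut k B) = B.
Proof.
apply/matrixP => i j; have [->|ik] := eqVneq i (lshift m k).
  by rewrite !emut_row opprK.
have [->|jk] := eqVneq j k; first by rewrite !emut_col opprK.
by rewrite emutE // emut_row emut_col emutE // sgzN mulrNN mulNr addrK.
Qed.

Lemma good_emut k B : good_matrix B -> good_matrix (emut k B).
Proof.
move=> gB; split; last first.
  by move=> ks; rewrite usubmx_emut; apply: (good_tsss gB (k :: ks)).
move=> w Hw.
(* A relation [w] between the mutated columns pulls back to a relation [w'] between the columns of
   [B]. The new entry is b_ij + b_ik [b_kj]_+ + [-b_ik]_+ b_kj; the last term sums to zero by the
   relation in row [k], so only the coefficient at [k] changes. *)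
pose pos j : int := signed_part true (B (lshift m k) j).
pose w' j := if j == k then (\sum_(l | l != k) pos l * w l) - w k else w j.
have w'off j : j != k -> w' j = w j by rewrite /w' => /negPf ->.
have rowk : \sum_(l | l != k) B (lshift m k) l * w l = 0.
  have := Hw (lshift m k); rewrite (bigD1 k) //= emut_row good_diag // oppr0 mul0r add0r.
  rewrite (eq_bigr (fun l => - (B (lshift m k) l * w l))) => [|l _].
    by rewrite sumrN => /eqP; rewrite oppr_eq0 => /eqP.
  by rewrite emut_row mulNr.
have w'0 : forall j, w' j = 0.
  apply: (good_indep gB) => i; rewrite (bigD1 k) //=.
  rewrite (eq_bigr (fun l => B i l * w l)); last by move=> l /w'off ->.
  have [->|ik] := eqVneq i (lshift m k); first by rewrite good_diag // mul0r add0r.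
  have := Hw i; rewrite (bigD1 k) //= emut_col.
  rewrite (eq_bigr (fun l => B i l * w l + (B i k * (pos l * w l)
     + (signed_part false (B i k))%:Z * (B (lshift m k) l * w l)))); last first.
    move=> l lk; rewrite emutE // mutation_termE /pos.
    have E1 := signed_part_sub true (B i k).
    have E2 := signed_part_sub true (B (lshift m k) l).
    rewrite !PoszM; move: E1 E2 => /=.
    move: (signed_part true _) (signed_part true _) => p q.
    move: (signed_part false _) (signed_part false _) => p' q' <- <-.
    ring.
  rewrite !big_split /= -!mulr_sumr rowk mulr0 addr0 => H.
  by rewrite /w' eqxx -[RHS]H; ring.
move=> j; have [->|jk] := eqVneq j k; last by rewrite -w'off.
have := w'0 k; rewrite /w' eqxx big1 => [|l lk]; last by rewrite -w'off // w'0 mulr0.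
by rewrite sub0r => /eqP; rewrite oppr_eq0 => /eqP.
Qed.

(* Makes the exchange polynomials at [j] and [k] separable by a grading. *)
Lemma good_minor B j k : good_matrix B -> j != k ->
  exists p q, B p j * B q k != B q j * B p k.
Proof.
move=> gB jk.
case: (boolP [exists p, [exists q, B p j * B q k != B q j * B p k]]).
  by move=> /existsP[p /existsP[q]]; exists p, q.
rewrite negb_exists => /forallP H.
have {}H p q : B p j * B q k = B q j * B p k.
  by have := H p; rewrite negb_exists => /forallP /(_ q); rewrite negbK => /eqP.
have kj : k != j by rewrite eq_sym.
have two (a b : int) i : \sum_l B i l * (if l == j then a else if l == k then b else 0)
    = B i j * a + B i k * b.
  rewrite (bigD1 j) //= eqxx (bigD1 k) //= (negPf kj) eqxx big1 ?addr0 // => l.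
  by move=> /andP[/negPf -> /negPf ->]; rewrite mulr0.
(* If all minors vanish, either row [p] gives the nontrivial relation with coefficients [B p k] and
   [- B p j] between the two columns, or column [j] is zero. *)
case: (boolP [exists p, B p j != 0]) => [/existsP[p Bp]|].
  have := @good_indep _ gB (fun l => if l == j then B p k else if l == k then - B p j else 0).
  move=> /(_ _ k); rewrite (negPf kj) eqxx => /(_ _) Bp0.
  by move: Bp; rewrite -oppr_eq0 Bp0 ?eqxx // => i; rewrite two -H; ring.
rewrite negb_exists => /forallP Bj.
have := @good_indep _ gB (fun l => if l == j then 1 else if l == k then 0 else 0).
move=> /(_ _ j); rewrite eqxx => /(_ _) H1.
have /eqP : (1 : int) = 0; last by rewrite oner_eq0.
by apply: H1 => i; rewrite two mulr0; move: (Bj i); rewrite negbK => /eqP ->; rewrite mul0r.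
Qed.

End ExtendedMatrices.

(** * Exchange relations along the path [j], [k], [j] *)

Section ThreeSteps.
Variables (n m : nat).
Let N := (n + m)%N.
Implicit Types (B : 'M[int]_(N, n)) (j k : 'I_n).

Lemma emonE (E : fieldType) B s k (x : 'I_N -> E) :
  emon B s k x = mon x (fun i => signed_part s (B i k)).
Proof. by []. Qed.

Lemma emu_off (E : fieldType) B j (x : 'I_N -> E) i :
  i != lshift m j -> emu B j x i = x i.
Proof. by rewrite /emu => /negPf ->. Qed.

Lemma emu_at (E : fieldType) B j (x : 'I_N -> E) :
  emu B j x (lshift m j) = eexch B j x / x (lshift m j).
Proof. by rewrite /emu eqxx. Qed.

Lemma eexch_sign (E : fieldType) s B j (x : 'I_N -> E) :
  eexch B j x = emon B s j x + emon B (~~ s) j x.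
Proof. by case: s; rewrite // addrC. Qed.

Lemma eexch_neq0 (E : fieldType) B j (x : 'I_N -> E) :
  nonvanishing B x -> eexch B j x != 0.
Proof.
move=> nv; have := nonvanishing_neq0 (lshift m j) (nonvanishing_emu j nv).
by rewrite emu_at mulf_eq0 negb_or => /andP[].
Qed.

Lemma emon_split (E : fieldType) B s j (x y : 'I_N -> E) p :
  (forall i, i != p -> y i = x i) ->
  emon B s j y = y p ^+ signed_part s (B p j) * mon x (off p (fun i => signed_part s (B i j))).
Proof. by move=> yx; rewrite emonE (mon_off _ yx). Qed.

Lemma emon_off (E : fieldType) B s j (x y : 'I_N -> E) p :
  (forall i, i != p -> y i = x i) -> B p j = 0 -> emon B s j y = emon B s j x.
Proof.
move=> yx B0; rewrite (emon_split _ _ _ yx) (@emon_split _ _ _ _ x x p) //.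
by rewrite B0 signed_part0 !expr0.
Qed.

(** Mutation at [k] swaps the two monomials of the exchange polynomial, neither of which contains
    x_k; hence its value is unchanged. *)
Lemma emuK (E : fieldType) B k (x : 'I_N -> E) : good_matrix B ->
  nonvanishing B x -> emu (emut k B) k (emu B k x) = x.
Proof.
move=> gB nv; apply: functional_extensionality => i.
have [->|ik] := eqVneq i (lshift m k); last by rewrite !emu_off.
rewrite !emu_at; suff -> : eexch (emut k B) k (emu B k x) = eexch B k x.
  by rewrite invf_div mulrCA divff ?mulr1 // eexch_neq0.
have E1 s : emon (emut k B) s k (emu B k x) = emon B (~~ s) k x.
  rewrite (@emon_off _ _ _ _ x _ (lshift m k)) ?emut_col ?good_diag ?oppr0 //.
    by rewrite !emonE; apply: eq_mon => i0; rewrite emut_col signed_partN.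
  by move=> i0; apply: emu_off.
by rewrite /eexch !E1 addrC.
Qed.

Lemma cvars_cancel (E : fieldType) B k (x : 'I_N -> E) ks : good_matrix B ->
  nonvanishing B x -> cvars B x [:: k, k & ks] = cvars B x ks.
Proof. by move=> gB nv; rewrite /= emutK emuK. Qed.

(* Mutations at [j], [k], [j]. When [B lj k] has sign [s], [x1 lj] occurs in only
   one of the two monomials of the second exchange relation. *)
Section Path.
Variables (B : 'M[int]_(N, n)) (j k : 'I_n).
Hypotheses (gB : good_matrix B) (jk : j != k).
Variables (E : fieldType) (x : 'I_N -> E).
Hypothesis nv : nonvanishing B x.

Let lj := lshift m j.
Let lk := lshift m k.
Let B1 := emut j B.
Let B2 := emut k B1.
Let x1 := emu B j x.
Let x2 := emu B1 k x1.
Let x3 := emu B2 j x2.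

Let ljk : lj != lk. Proof. by rewrite lshift_eq. Qed.
Let lkj : lk != lj. Proof. by rewrite eq_sym. Qed.
Let kj : k != j. Proof. by rewrite eq_sym. Qed.
Let x0 i : x i != 0. Proof. exact: nonvanishing_neq0 nv. Qed.

Lemma commuting_step2 : B lj k = 0 -> B lk j = 0 -> x2 lk = eexch B k x / x lk.
Proof.
move=> Bjk Bkj; rewrite /x2 emu_at /x1 (emu_off _ _ lkj); congr (_ / _).
have E1 s : emon B1 s k (emu B j x) = emon B s k x.
  rewrite (@emon_off _ _ _ _ x _ lj); first last.
  - by rewrite /B1 emut_row Bjk oppr0.
  - by move=> i; apply: emu_off.
  rewrite !emonE; apply: eq_mon => i.
  have [->|ij] := eqVneq i lj; first by rewrite /B1 emut_row Bjk oppr0.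
  by rewrite /B1 emutE // Bjk mulr0 maxxx mulr0 addr0.
by rewrite /eexch !E1.
Qed.

(** The mutation at [k] leaves column [j] and its variables alone, so the third mutation undoes the
    first. *)
Lemma commuting_step3 : B lj k = 0 -> B lk j = 0 -> x3 lj = x lj.
Proof.
move=> Bjk Bkj; rewrite /x3 emu_at /x2 emu_off // /x1 emu_at.
have B2j i : B2 i j = - B i j.
  have [->|ik] := eqVneq i lk; first by rewrite /B2 emut_row /B1 emut_col opprK Bkj oppr0.
  by rewrite /B2 emutE // /B1 !emut_col Bkj oppr0 mulr0 maxxx mulr0 addr0.
have E1 s : emon B2 s j (emu B1 k (emu B j x)) = emon B (~~ s) j x.
  rewrite (@emon_off _ _ _ _ (emu B j x) _ lk); first last.
  - by rewrite B2j Bkj oppr0.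
  - by move=> i; apply: emu_off.
  rewrite (@emon_off _ _ _ _ x _ lj); first last.
  - by rewrite B2j good_diag // oppr0.
  - by move=> i; apply: emu_off.
  by rewrite !emonE; apply: eq_mon => i; rewrite B2j signed_partN.
have -> : eexch B2 j (emu B1 k (emu B j x)) = eexch B j x by rewrite /eexch !E1 addrC.
by rewrite invf_div mulrCA divff ?mulr1 // eexch_neq0.
Qed.

Variable s : bool.
Hypotheses (Bjk : signed_part (~~ s) (B lj k) = 0%N) (Bkj : signed_part s (B lk j) = 0%N).

Lemma path_step1 :
  x1 lj * x lj = mon x (off lk (fun i => signed_part s (B i j)))
    + x lk ^+ signed_part (~~ s) (B lk j) * mon x (off lk (fun i => signed_part (~~ s) (B i j))).
Proof.
rewrite /x1 emu_at divfK // (eexch_sign s).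
by rewrite !(@emon_split _ _ _ _ x x lk) // Bkj expr0 mul1r.
Qed.

Lemma path_step2 :
  x2 lk * x lk = mon x (off lj (fun i => signed_part s (B1 i k)))
    + x1 lj ^+ signed_part s (B lj k) * mon x (off lj (fun i => signed_part (~~ s) (B1 i k))).
Proof.
rewrite /x2 emu_at -/x1.
have -> : x1 lk = x lk by apply: emu_off.
rewrite divfK // (eexch_sign s).
have off1 i : i != lj -> x1 i = x i by apply: emu_off.
rewrite !(emon_split _ _ _ off1) /B1 emut_row !signed_partN negbK.
by rewrite Bjk expr0 mul1r.
Qed.

Lemma path_step3 :
  x3 lj * x1 lj = mon x (off lj (off lk (fun i => signed_part s (B2 i j))))
    + x2 lk ^+ signed_part (~~ s) (B lk j)
      * mon x (off lj (off lk (fun i => signed_part (~~ s) (B2 i j)))).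
Proof.
rewrite /x3 emu_at -/x2.
have -> : x2 lj = x1 lj by apply: emu_off.
have x1j : x1 lj != 0 by apply: (nonvanishing_neq0 _ (nonvanishing_emu j nv)).
rewrite divfK // (eexch_sign s).
have off1 i : i != lj -> x1 i = x i by apply: emu_off.
have off2 i : i != lk -> x2 i = x1 i by apply: emu_off.
have B2j s' : signed_part s' (B2 lj j) = 0%N.
  rewrite /B2 emutE // /B1 emut_row good_diag // emut_col emut_row.
  rewrite (_ : Num.max _ _ = 0) ?mulr0 ?oppr0 ?addr0 ?signed_part0 //.
  apply: max_r; rewrite mulrNN.
  by case: (good_sign gB j k) => [/ltW//|[-> ->]]; rewrite mulr0.
have offj f : off lk f lj = f lj by rewrite /off (negPf ljk).
rewrite !(emon_split _ _ _ off2) !(mon_off _ off1) !offj !B2j !expr0 !mul1r.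
by rewrite /B2 emut_row /B1 emut_col opprK Bkj expr0 mul1r.
Qed.

(** When the new variable [x1 lj] is set to zero, [x2 lk] becomes a monomial over x_k. This identity
    then makes the third exchange polynomial a monomial multiple of the first one; it is the
    mutation rule for column [j] of [B2]. *)
Lemma path_exponents i :
  (off lj (off lk (fun i => signed_part s (B2 i j))) i
     + off lk (fun i => signed_part s (B i j)) i)%N =
  (off lj (off lk (fun i => signed_part (~~ s) (B2 i j))) i
     + off lk (fun i => signed_part (~~ s) (B i j)) i
     + signed_part (~~ s) (B lk j) * off lj (fun i => signed_part s (B1 i k)) i)%N.
Proof.
rewrite /off; have [->|ij] := eqVneq i lj.
  by rewrite (negPf ljk) good_diag // !signed_part0 muln0.
have [->|ik] := eqVneq i lk.
  rewrite /B1 emutE // good_diag // (_ : Num.max _ _ = 0) ?mulr0 ?addr0 ?signed_part0 ?muln0 //.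
  apply: max_r; rewrite mulrC.
  by case: (good_sign gB j k) => [/ltW//|[-> ->]]; rewrite mulr0.
have E1 : B2 i j = - B i j + (if s then 1 else -1)
    * (signed_part s (B1 i k) * signed_part (~~ s) (B lk j))%:Z.
  rewrite /B2 emutE // (@mutation_term_sign s); first by rewrite /B1 !emut_col signed_partN.
  rewrite /B1 emut_col -/lk; move: Bkj; rewrite /signed_part; move: (B lk j) => b.
  by case: (s) => /=; lia.
have := signed_part_sub s (B i j); have := signed_part_sub s (B2 i j).
rewrite E1 mulnC; move: (_ * _)%N => t.
by case: (s); rewrite /= ?mul1r ?mulN1r; lia.
Qed.

End Path.
End ThreeSteps.

(** * The Laurent phenomenon *)

Section LaurentPhenomenon.
Variables (n m : nat).
Let N := (n + m)%N.
Implicit Types (B : 'M[int]_(N, n)) (j k : 'I_n).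

Lemma laurent_eexch B C j : laurent B (fun E x => eexch C j x).
Proof. exact: (laurentD (laurent_mon _ _) (laurent_mon _ _)). Qed.

Lemma laurent_emu B j i : laurent B (fun E x => emu B j x i).
Proof.
rewrite /emu; case: (i == _); last exact: laurent_var.
exact: (laurentM (laurent_eexch B B j) (laurent_varV B i)).
Qed.

Lemma ev_eexch (E : fieldType) (x : 'I_N -> E) B j s :
  ev x ('X_[mvec (fun i => signed_part s (B i j))]
        + 'X_[mvec (fun i => signed_part (~~ s) (B i j))]) = eexch B j x.
Proof. by rewrite evD !ev_mvec (eexch_sign s). Qed.

(** * Regularity of the new variables modulo F_j *)

Section Regularity.
Variables (B : 'M[int]_(N, n)) (j k : 'I_n).
Hypotheses (gB : good_matrix B) (jk : j != k).
Let lj := lshift m j.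
Let lk := lshift m k.
Let lkj : lk != lj. Proof. by rewrite lshift_eq eq_sym. Qed.
Let fj : field_map n m := fun E x => eexch B j x.
Let s2 : field_map n m := fun E x => emu (emut j B) k (emu B j x) lk.
Let s3 : field_map n m := fun E x =>
  emu (emut k (emut j B)) j (emu (emut j B) k (emu B j x)) lj.

Lemma regular_exchange_pair : regular_mod B fj (fun E x => eexch B k x).
Proof.
have [p [q pq]] := good_minor gB jk.
(* This weight is orthogonal to column [j], so F_j is homogeneous; on column [k] it gives the
   nonzero minor up to sign, so the two monomials of F_k have different weights. *)
pose ell i : int := (i == p)%:Z * B q j - (i == q)%:Z * B p j.
have wE (v : 'I_N -> nat) : weight ell (mvec v) = B q j * (v p)%:Z - B p j * (v q)%:Z.
  rewrite /weight (eq_bigr (fun i => (i == p)%:Z * (B q j * (v i)%:Z)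
                                    - (i == q)%:Z * (B p j * (v i)%:Z))).
    rewrite sumrB (bigD1 p) //= eqxx mul1r big1 ?addr0 => [|i /negPf->]; last by rewrite mul0r.
    by rewrite (bigD1 q) //= eqxx mul1r big1 ?addr0 // => i /negPf->; rewrite mul0r.
  by move=> i _; rewrite mnmE /ell; ring.
pose V l s := mvec (fun i => signed_part s (B i l)).
have wV l : weight ell (V l true) - weight ell (V l false) = B q j * B p l - B p j * B q l.
  rewrite !wE; have := signed_part_sub true (B p l); have := signed_part_sub true (B q l).
  move=> /=; move: (signed_part true (B q l)) (signed_part false (B q l)) => a a'.
  by move: (signed_part true _) (signed_part false _) => b b' <- <-; ring.
have hj : weight ell (V j false) = weight ell (V j true).
  by apply/eqP; rewrite eq_sym -subr_eq0 wV mulrC subrr.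
have hA : whomog ell (weight ell (V j true)) ('X_[V j true] + 'X_[V j false] : {mpoly int[N]}).
  by apply: whomogD; [exact: whomogX | rewrite -hj; exact: whomogX].
have hk : weight ell (V k true) != weight ell (V k false).
  by rewrite -subr_eq0 wV subr_eq0 eq_sym.
have reg := @regular_mod_weights n m B ell _ _ _ _ _ hA (@whomogX _ _ _ (V k false)) hk.
move=> g Lg [w Lw Hw]; have [|w' Lw' Hw'] := reg g Lg.
  exists w => // E x nv; rewrite (ev_eexch x B k true) (ev_eexch x B j true).
  exact: Hw.
by exists w' => // E x nv; rewrite Hw' // (ev_eexch x B j true).
Qed.

(** Here [s2] is F_k up to a unit, and [s3] is the unit x_j. *)
Lemma regular_commuting : B lj k = 0 -> B lk j = 0 ->
  [/\ laurent B s2, laurent B s3, regular_mod B fj s2 & regular_mod B fj s3].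
Proof.
move=> Bjk Bkj.
have e2 (E : fieldType) (x : 'I_N -> E) : nonvanishing B x -> eexch B k x / x lk = s2 x.
  by move=> nv; rewrite /s2 commuting_step2.
have e3 (E : fieldType) (x : 'I_N -> E) : nonvanishing B x -> x lj = s3 x.
  by move=> nv; rewrite /s3 commuting_step3.
split.
- exact: (eq_laurent e2 (laurentM (laurent_eexch B B k) (laurent_varV B lk))).
- exact: (eq_laurent e3 (laurent_var B lj)).
- apply: (regular_mod_congr (laurent_var B lk) (laurent_int B 0) _ regular_exchange_pair).
  move=> E x nv; rewrite -e2 // mulr0 addr0 divfK //; exact: nonvanishing_neq0 nv.
apply: (regular_mod_unit (laurent_varV B lj)) => E x nv.
by rewrite -e3 // mulVf //; exact: nonvanishing_neq0 nv.
Qed.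

(** Since [y] is F_j over the unit x_j, one may compute modulo [y]. Up to units, [s2] becomes a
    monomial and [s3] a polynomial ['X_[e] + 'X_[g] *+ rho] in which only ['X_[e]] contains x_j. *)
Lemma regular_noncommuting s :
  signed_part (~~ s) (B lj k) = 0%N -> signed_part s (B lk j) = 0%N ->
  (0 < signed_part s (B lj k))%N ->
  [/\ laurent B s2, laurent B s3, regular_mod B fj s2 & regular_mod B fj s3].
Proof.
move=> Bjk Bkj c_gt0.
set c := signed_part s (B lj k) in c_gt0.
pose r := signed_part (~~ s) (B lk j).
pose v0 := off lj (fun i => signed_part s (emut j B i k)).
pose v1 := off lj (fun i => signed_part (~~ s) (emut j B i k)).
pose us := off lj (off lk (fun i => signed_part s (emut k (emut j B) i j))).
pose ut := off lj (off lk (fun i => signed_part (~~ s) (emut k (emut j B) i j))).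
pose ms := off lk (fun i => signed_part s (B i j)).
pose mt := off lk (fun i => signed_part (~~ s) (B i j)).
pose y : field_map n m := fun E x => emu B j x lj.
have Ly : laurent B y := laurent_emu B j lj.
have x0 (E : fieldType) (x : 'I_N -> E) i : nonvanishing B x -> x i != 0.
  exact: nonvanishing_neq0.
have y0 (E : fieldType) (x : 'I_N -> E) : nonvanishing B x -> y E x != 0.
  by move=> nv; apply: (nonvanishing_neq0 _ (nonvanishing_emu j nv)).
have fjE (E : fieldType) (x : 'I_N -> E) : nonvanishing B x -> fj x = y E x * x lj.
  by move=> nv; rewrite /y emu_at divfK ?x0.
have H1 (E : fieldType) (x : 'I_N -> E) (nv : nonvanishing B x) :
    y E x * x lj = mon x ms + x lk ^+ r * mon x mt.
  exact: path_step1.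
have H2 (E : fieldType) (x : 'I_N -> E) (nv : nonvanishing B x) :
    s2 x * x lk = mon x v0 + y E x ^+ c * mon x v1.
  exact: path_step2.
have H3 (E : fieldType) (x : 'I_N -> E) (nv : nonvanishing B x) :
    s3 x * y E x = mon x us + s2 x ^+ r * mon x ut.
  exact: path_step3.
have Hexp (E : fieldType) (x : 'I_N -> E) :
    mon x us * mon x ms = mon x ut * mon x mt * mon x v0 ^+ r.
  by rewrite monXn !monD; apply: eq_mon => i; apply: path_exponents.
have L2 : laurent B s2.
  apply: (eq_laurent _ (laurentM (laurentD (laurent_mon B v0)
    (laurentM (laurentXn c Ly) (laurent_mon B v1))) (laurent_varV B lk))) => E x nv.
  by rewrite -H2 // mulfK ?x0.
have [T LT HT] := laurent_exprD r (laurent_mon B v0) (laurentM (laurentXn c Ly) (laurent_mon B v1)).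
(* The r-th power of [s2 * x lk] is expanded to first order in [y]. The linear coefficient is [rho]
   times the monomial [w], where [rho] is [r] if [c = 1] and 0 if [c > 1]. *)
pose w i := (r.-1 * v0 i + v1 i)%N.
have [rho [T2 LT2 HT2]] : exists rho : nat, exists2 T2, laurent B T2 &
    forall (E : fieldType) (x : 'I_N -> E), nonvanishing B x ->
    (s2 x * x lk) ^+ r = mon x v0 ^+ r + y E x * (mon x w *+ rho + y E x * T2 E x).
  have wE (E : fieldType) (x : 'I_N -> E) : mon x w = mon x v0 ^+ r.-1 * mon x v1.
    by rewrite monXn monD.
  case: c c_gt0 H2 HT => [//|[|c]] _ H2 HT.
    exists r, (fun E x => mon x v1 ^+ 2 * T E x); first exact: laurentM (laurentXn 2 (laurent_mon B v1)) LT.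
    move=> E x nv; rewrite H2 // HT wE !expr1 -addrA; congr (_ + _).
    rewrite -(mulr_natr (_ * (_ * _)) r) -(mulr_natr (_ * mon x v1) r).
    by move: (mon x v0 ^+ r.-1) (mon x v1) (y E x) (T E x) (r%:R) => a1 a2 a3 a4 a5; ring.
  exists 0%N, (fun E x => mon x v0 ^+ r.-1 * (y E x ^+ c * mon x v1) * r%:~R
                     + y E x ^+ 2 * (y E x ^+ c * mon x v1) ^+ 2 * T E x).
    have Lg := laurentM (laurentXn c Ly) (laurent_mon B v1).
    apply: laurentD (laurentM (laurentM (laurentXn r.-1 (laurent_mon B v0)) Lg) (laurent_int B r)) _.
    exact: laurentM (laurentM (laurentXn 2 Ly) (laurentXn 2 Lg)) LT.
  move=> E x nv; rewrite H2 // HT mulr0n add0r -addrA; congr (_ + _).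
  rewrite -(mulr_natr (_ * (_ * _)) r) !exprS -pmulrn.
  move: (mon x v0 ^+ r.-1) (mon x v1) (T E x) (r%:R) (y E x ^+ c) (y E x) => a1 a2 a3 a4 a5 a6.
  by rewrite expr0; ring.
have w0 : w lj = 0%N by rewrite /w /v0 /v1 /off eqxx muln0.
clearbody w.
pose e := mvec (fun i => us i + (i == lj))%N.
pose g := mvec (fun i => ut i + mt i + w i)%N.
pose l : field_map n m := fun E x => (x lj)^-1 * (mon x ut * mon x mt * T2 E x).
have Ll : laurent B l.
  exact: laurentM (laurent_varV B lj) (laurentM (laurentM (laurent_mon B ut) (laurent_mon B mt)) LT2).
(* By [Hexp] the part of [s3 * y] without [T2] is a multiple of [y * x lj], so it
   contributes only the monomial [e], of degree 1, in [x lj]. *)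
have s3E (E : fieldType) (x : 'I_N -> E) : nonvanishing B x ->
    s3 x * (x lk ^+ r * mon x mt) = ev x ('X_[e] + 'X_[g] *+ rho) + fj x * l E x.
  move=> nv; apply: (mulfI (y0 E x nv)).
  rewrite evD [ev x (_ *+ _)]mmapMn -/(ev x _) !ev_mvec -!monD fjE //.
  have -> : mon x (fun i => nat_of_bool (i == lj)) = x lj.
    rewrite /mon (bigD1 lj) //= eqxx expr1 big1 ?mulr1 // => i /negPf ->; exact: expr0.
  have -> : y E x * (s3 x * (x lk ^+ r * mon x mt)) = s3 x * y E x * x lk ^+ r * mon x mt.
    by move: (s3 x) (y E x) (x lk ^+ r) (mon x mt) => b1 b2 b3 b4; ring.
  rewrite H3 //.
  transitivity (mon x us * x lk ^+ r * mon x mt + (s2 x * x lk) ^+ r * mon x ut * mon x mt).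
    rewrite exprMn; move: (s2 x ^+ r) (x lk ^+ r) => d1 d2.
    by move: (mon x us) (mon x ut) (mon x mt) => a1 a2 a3; ring.
  rewrite HT2 //.
  transitivity (mon x us * (y E x * x lj)
    + mon x ut * mon x mt * (y E x * (mon x w *+ rho + y E x * T2 E x))).
    rewrite H1 // [mon x us * (_ + _)]mulrDr Hexp; move: (mon x v0 ^+ r) (x lk ^+ r) => a0 d2.
    rewrite -(mulr_natr (mon x w) rho); move: (mon x us) (mon x ut) (mon x mt) (mon x w) (T2 E x) (y E x).
    by move: (rho%:R) => b0 b1 b2 b3 b4 b5 b6; ring.
  have xj0 : x lj != 0 by apply: x0.
  rewrite -(mulr_natr (mon x w) rho) -(mulr_natr (_ * mon x w) rho) /l.
  move: (mon x us) (mon x ut) (mon x mt) (mon x w) (T2 E x) (y E x) (x lj) xj0.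
  by move=> a1 a2 a3 a4 a5 a6 a7 a7_neq0; field.
have LU : laurent B (fun E x => x lk ^+ r * mon x mt).
  exact: laurentM (laurentXn r (laurent_var B lk)) (laurent_mon B mt).
have LU' : laurent B (fun E x => (x lk)^-1 ^+ r * (mon x mt)^-1).
  exact: laurentM (laurentXn r (laurent_varV B lk)) (laurent_monV B mt).
have L3 : laurent B s3.
  apply: (eq_laurent _ (laurentM (laurentD (laurent_ev B ('X_[e] + 'X_[g] *+ rho))
    (laurentM (laurent_eexch B B j) Ll)) LU')) => E x nv.
  rewrite -s3E // exprVn -invfM mulfK // mulf_neq0 ?expf_neq0 ?x0 // mon_neq0 // => i.
  exact: x0.
split=> //.
(* Because [c] is positive, [s2 * x lk] is congruent modulo F_j to the monomial [v0], a unit. *)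
- have [c' cE] : exists c', c = c'.+1 by case: c c_gt0 {H2 HT} => // c' _; exists c'.
  apply: (@regular_mod_congr _ _ _ _ (fun E x => mon x v0) _ (fun E x => x lk)
    (fun E x => (x lj)^-1 * (y E x ^+ c' * mon x v1)) (laurent_var B lk)).
  + exact: laurentM (laurent_varV B lj) (laurentM (laurentXn c' Ly) (laurent_mon B v1)).
  + move=> E x nv; rewrite H2 // fjE // cE exprS; congr (_ + _).
    by rewrite [_ * (_^-1 * _)]mulrA mulfK ?x0 // mulrA.
  apply: (regular_mod_unit (laurent_monV B v0)) => E x nv.
  by rewrite mulVf // mon_neq0 // => i; apply: x0.
pose A : {mpoly int[N]} := 'X_[mvec (fun i => signed_part true (B i j))]
  + 'X_[mvec (fun i => signed_part false (B i j))].
(* In the grading by the degree in x_j, F_j and ['X_[g]] have degree 0 and ['X_[e]] has degree 1. *)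
have reg : regular_mod B (fun E x => ev x A) (fun E x => ev x ('X_[e] + 'X_[g] *+ rho)).
  apply: (@regular_mod_weights n m B (fun i => (i == lj)%:Z) 0 0).
  - by apply: whomogD => i; rewrite msuppX mem_seq1 => /eqP ->; rewrite weight_delta good_diag ?signed_part0.
  - apply: whomogMn => i; rewrite msuppX mem_seq1 => /eqP ->.
    rewrite weight_delta w0 /ut /mt /off eqxx addn0 add0n.
    by rewrite eq_sym (negPf lkj) good_diag ?signed_part0.
  by rewrite weight_delta /us /off eqxx.
have {}reg : regular_mod B fj (fun E x => ev x ('X_[e] + 'X_[g] *+ rho)).
  move=> h Lh [h' Lh' Hh']; have [|h2 Lh2 Hh2] := reg h Lh.
    by exists h' => // E x nv; rewrite (ev_eexch x B j true); apply: Hh'.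
  by exists h2 => // E x nv; rewrite Hh2 // (ev_eexch x B j true).
exact: (regular_mod_congr LU Ll s3E reg).
Qed.

Lemma regular_steps :
  [/\ laurent B s2, laurent B s3, regular_mod B fj s2 & regular_mod B fj s3].
Proof.
case: (good_sign gB j k) => [neg|[]]; last exact: regular_commuting.
have [Bp|Bn] : (0 < B lj k /\ B lk j < 0) \/ (B lj k < 0 /\ 0 < B lk j).
- move: neg; rewrite -/lj -/lk; move: (B lj k) (B lk j) => a b ab.
  have [an|[a0|ap]] : a < 0 \/ a = 0 \/ 0 < a by lia.
  + by right; nia.
  + by move: ab; rewrite a0 mul0r ltxx.
  by left; nia.
- by apply: (@regular_noncommuting true); rewrite /signed_part -/lj -/lk /=; lia.
by apply: (@regular_noncommuting false); rewrite /signed_part -/lj -/lk /=; lia.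
Qed.

End Regularity.

(* [g1] and [g3] express [f] in the clusters at the ends of the mutation paths
   [j] and [j, k, j]; the denominators of the second are regular modulo [F_j]. *)
Lemma laurent_cvars_step (f : field_map n m) B j k (gB : good_matrix B) (jk : j != k)
    (g1 : field_map n m) (g3 : field_map n m) :
  laurent (emut j B) g1 ->
  laurent (emut j (emut k (emut j B))) g3 ->
  (forall (E : fieldType) (x : 'I_N -> E), nonvanishing B x ->
     f E x = g1 E (emu B j x)) ->
  (forall (E : fieldType) (x : 'I_N -> E), nonvanishing B x ->
     f E x = g3 E (emu (emut k (emut j B)) j (emu (emut j B) k (emu B j x)))) ->
  laurent B f.
Proof.
move=> [q1 [d1 H1]] [q3 [d3 H3]] fg1 fg3.
pose lj := lshift m j; pose lk := lshift m k.
have ljk : lj != lk by rewrite lshift_eq.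
have [L2 L3 R2 R3] := regular_steps gB jk.
have x0 (E : fieldType) (x : 'I_N -> E) i : nonvanishing B x -> x i != 0.
  exact: nonvanishing_neq0.
pose y (E : fieldType) (x : 'I_N -> E) := emu B j x.
pose z (E : fieldType) (x : 'I_N -> E) := emu (emut k (emut j B)) j (emu (emut j B) k (y E x)).
have dE (E : fieldType) (x : 'I_N -> E) (d : 'X_{1..N}) : ev x 'X_[d] = mon x (fun i => d i).
  by rewrite evX.
(* The multiplier clears the two new variables from the denominator of [g3], and the power [d1 lj]
   of F_j clears the new variable F_j / x_j from that of [g1]. All remaining denominators are
   monomials in [x]. *)
apply: (@laurent_descent _ _ _ _ (fun E x => eexch B j x)
  (fun E x => z E x lj ^+ d3 lj * z E x lk ^+ d3 lk) (d1 lj)).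
- exact: laurent_eexch.
- by move=> E x; apply: eexch_neq0.
- have zk (E : fieldType) (x : 'I_N -> E) : z E x lk = emu (emut j B) k (emu B j x) lk.
    by rewrite /z emu_off // eq_sym.
  apply: (@regular_modM _ _ _ _ (fun E x => z E x lj ^+ d3 lj) (fun E x => z E x lk ^+ d3 lk)); first last.
  + apply: (@regular_modXn _ _ _ _ (fun E x => z E x lk)).
      by apply: eq_laurent L2 => E x _; rewrite zk.
    apply: (regular_mod_congr (laurent_int B 1) (laurent_int B 0) _ R2) => E x _.
    by rewrite zk mulr1 mulr0 addr0.
  + exact: (@regular_modXn _ _ _ _ (fun E x => z E x lj) (d3 lj) L3 R3).
  apply: (@laurentXn _ _ _ (fun E x => z E x lk)).
  by apply: eq_laurent L2 => E x _; rewrite zk.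
- pose v := off lj (off lk (off lj (fun i => d3 i))).
  have Lq : laurent B (fun E x => ev (z E x) q3).
    apply: (@laurent_comp _ _ _ (fun i E x => z E x i)) => i.
    have [->|ij] := eqVneq i lj; first exact: L3.
    have [->|ik] := eqVneq i lk.
      by apply: eq_laurent L2 => E x _; rewrite /z [RHS]emu_off // eq_sym.
    apply: eq_laurent (laurent_var B i) => E x _.
    by rewrite /z /y !emu_off.
  apply: eq_laurent (laurentM Lq (laurent_monV B v)) => E x nv.
  have := H3 E (z E x); rewrite -fg3 // dE => <-; last first.
    by do 3 apply: nonvanishing_emu.
  have off3 i : i != lj -> z E x i = emu (emut j B) k (y E x) i by apply: emu_off.
  have off2 i : i != lk -> emu (emut j B) k (y E x) i = y E x i by apply: emu_off.
  have off1 i : i != lj -> y E x i = x i by apply: emu_off.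
  rewrite (mon_off _ off3) (mon_off _ off2) (mon_off _ off1) -/v.
  have -> : off lk (off lj (fun i => d3 i)) lj = 0%N by rewrite /off eqxx (negPf ljk).
  have -> : off lj (fun i => d3 i) lk = d3 lk by rewrite /off eq_sym (negPf ljk).
  rewrite (off3 lk); last by rewrite eq_sym.
  rewrite expr0 mul1r -!mulrA mulfV ?mulr1 //.
  by apply: mon_neq0 => i; apply: x0.
pose v := off lj (fun i => d1 i).
have Lq : laurent B (fun E x => ev (y E x) q1).
  by apply: (@laurent_comp _ _ _ (fun i E x => y E x i)) => i; apply: laurent_emu.
have Lw := laurentM (laurentM Lq (laurent_monV B v)) (laurentXn (d1 lj) (laurent_var B lj)).
apply: eq_laurent Lw => E x nv.
have := H1 E (y E x) (nonvanishing_emu j nv); rewrite -fg1 // dE => <-.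
have off1 i : i != lj -> y E x i = x i by apply: emu_off.
rewrite (mon_off _ off1) -/v mulrA mulfK; last by apply: mon_neq0 => i; apply: x0.
by rewrite -mulrA -exprMn /y emu_at divfK // x0.
Qed.

(** Induction on the length of the word; a repeated first letter cancels, and otherwise
    [laurent_cvars_step] applies. *)
Theorem laurent_cvars B ks i : good_matrix B -> laurent B (fun E x => cvars B x ks i).
Proof.
have [d] := ubnP (size ks); elim: d ks B i => // d IH [|j [|k ks]] B i /= sz gB.
- exact: laurent_var.
- exact: laurent_emu.
have [jk|jk] := eqVneq j k.
  apply: eq_laurent (IH ks B i _ gB); last by lia.
  by move=> E x nv; rewrite -jk emutK emuK.
have gB1 := good_emut j gB; have gB2 := good_emut k gB1; have gB3 := good_emut j gB2.
(* From the far end of [j], [k], [j], the word [j :: ks] first undoes the last mutation and so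
   reaches the same cluster; it too is shorter than the original word. *)
apply: (laurent_cvars_step gB jk (IH (k :: ks) _ i _ gB1) (IH (j :: ks) _ i _ gB3)) => //.
move=> E x nv; have nv2 := nonvanishing_emu k (nonvanishing_emu j nv).
by rewrite -(cvars_cancel j _ gB2 nv2).
Qed.

End LaurentPhenomenon.

(** * Separation of additions *)

Section GroupRing.
Variables (P : groupType) (F : fieldType) (iota : P -> F).
Hypothesis gre : group_ring_embedding iota.

Lemma iota_neq0 a : iota a != 0.
Proof.
apply/eqP => a0; have := greM gre a a^-1%g.
by rewrite mulgV (gre1 gre) a0 mul0r => /eqP; rewrite oner_eq0.
Qed.

Lemma iotaV a : iota a^-1%g = (iota a)^-1.
Proof.
by apply: (mulfI (iota_neq0 a)); rewrite -(greM gre) mulgV (gre1 gre) divff ?iota_neq0.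
Qed.

(** Two distinct elements with equal images would satisfy a relation with coefficients 1 and -1. *)
Lemma iota_inj : injective iota.
Proof.
move=> a b ab; apply/eqP/negPn/negP => /eqP anb.
pose p (i : 'I_2) := if i == ord0 then a else b.
pose c (i : 'I_2) : int := if i == ord0 then 1 else -1.
have p_inj : injective p.
  move=> i j; rewrite /p; case: (i =P ord0) => [->|/eqP i0]; case: (j =P ord0) => [->|/eqP j0] //.
    by move/esym/anb.
  by move=> _; apply/val_inj; case: i i0 => [[|[]]] //; case: j j0 => [[|[]]].
have := @gre_indep _ _ _ gre 2 p c p_inj.
rewrite !big_ord_recl big_ord0 /p /c /= ab => /(_ _ ord0) /= H.
suff : (1 : int) = 0 by move/eqP; rewrite oner_eq0.
by apply: H; rewrite mulrN1z mulr1z mulN1r mul1r addr0 subrr.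
Qed.

Lemma iotaX a k : iota (a ^+ k)%g = iota a ^+ k.
Proof. by elim: k => [|k IH]; rewrite ?expg0 ?(gre1 gre) // expgS (greM gre) IH exprS. Qed.

Lemma iota_gexpz a z : iota (gexpz a z) = iota a ^ z.
Proof. by case: z => k /=; rewrite ?iotaV iotaX. Qed.

Lemma iota_mon N (g : 'I_N -> P) v : exists a, iota a = mon (fun i => iota (g i)) v.
Proof.
apply: (big_ind (fun z => exists a, iota a = z)) => [|_ _ [a <-] [b <-]|i _].
- by exists 1%g; rewrite (gre1 gre).
- by exists (a * b)%g; rewrite (greM gre).
by exists (g i ^+ v i)%g; rewrite iotaX.
Qed.

Lemma in_ZP0 : in_ZP iota 0.
Proof. by exists 0%N, (fun=> 1%g), (fun=> 0); rewrite big_ord0. Qed.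

Lemma in_ZPD f g : in_ZP iota f -> in_ZP iota g -> in_ZP iota (f + g).
Proof.
move=> [m1 [p1 [c1 ->]]] [m2 [p2 [c2 ->]]]; exists (m1 + m2)%N.
exists (fun i => match split i with inl a => p1 a | inr b => p2 b end).
exists (fun i => match split i with inl a => c1 a | inr b => c2 b end).
rewrite big_split_ord /=; congr (_ + _); apply: eq_bigr => i _.
  by have /= -> := unsplitK (inl i : 'I_m1 + 'I_m2)%type.
by have /= -> := unsplitK (inr i : 'I_m1 + 'I_m2)%type.
Qed.

Lemma in_ZP_int_iota (c : int) a : in_ZP iota (c%:~R * iota a).
Proof. by exists 1%N, (fun=> a), (fun=> c); rewrite big_ord1. Qed.

Lemma in_ZP_iota a : in_ZP iota (iota a).
Proof. by have := in_ZP_int_iota 1 a; rewrite mul1r. Qed.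

Lemma in_ZP_int (c : int) : in_ZP iota c%:~R.
Proof. by have := in_ZP_int_iota c 1%g; rewrite (gre1 gre) mulr1. Qed.

Lemma in_ZP_sum (I : Type) (r : seq I) (Q : pred I) (f : I -> F) :
  (forall i, Q i -> in_ZP iota (f i)) -> in_ZP iota (\sum_(i <- r | Q i) f i).
Proof. by move=> H; apply: (big_ind (in_ZP iota)) => //; [exact: in_ZP0 | exact: in_ZPD]. Qed.

Lemma in_ZPM f g : in_ZP iota f -> in_ZP iota g -> in_ZP iota (f * g).
Proof.
move=> [m1 [p1 [c1 ->]]] [m2 [p2 [c2 ->]]]; rewrite mulr_suml.
apply: in_ZP_sum => i _; rewrite mulr_sumr; apply: in_ZP_sum => j _.
by rewrite mulrACA -intrM -(greM gre); apply: in_ZP_int_iota.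
Qed.

Section ZPPolynomials.
Variable n : nat.
Implicit Types p q : {mpoly F[n]}.

Lemma ZP_mpolyD p q : ZP_mpoly iota p -> ZP_mpoly iota q -> ZP_mpoly iota (p + q).
Proof. by move=> hp hq m; rewrite mcoeffD; apply: in_ZPD. Qed.

Lemma ZP_mpolyM p q : ZP_mpoly iota p -> ZP_mpoly iota q -> ZP_mpoly iota (p * q).
Proof. by move=> hp hq m; rewrite mcoeffM; apply: in_ZP_sum => k _; apply: in_ZPM. Qed.

Lemma ZP_mpolyC c : in_ZP iota c -> ZP_mpoly iota (c%:MP : {mpoly F[n]}).
Proof. by move=> hc m; rewrite mcoeffC pmulrn; apply: in_ZPM => //; apply: in_ZP_int. Qed.

Lemma ZP_mpolyX m : ZP_mpoly iota ('X_[m] : {mpoly F[n]}).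
Proof. by move=> m'; rewrite mcoeffX pmulrn; apply: in_ZP_int. Qed.

Lemma ZP_mpolyN p : ZP_mpoly iota p -> ZP_mpoly iota (- p).
Proof.
move=> hp m; rewrite mcoeffN -mulN1r -[-1](mulrN1z 1); apply: in_ZPM => //.
exact: in_ZP_int.
Qed.

Lemma ZP_mpolyZ c p : in_ZP iota c -> ZP_mpoly iota p -> ZP_mpoly iota (c *: p).
Proof. by move=> hc hp m; rewrite mcoeffZ; apply: in_ZPM. Qed.

Lemma ZP_mpolyXn p k : ZP_mpoly iota p -> ZP_mpoly iota (p ^+ k).
Proof.
move=> hp; elim: k => [|k IH]; last by rewrite exprS; apply: ZP_mpolyM.
by rewrite expr0 -mpolyX0; apply: ZP_mpolyX.
Qed.

End ZPPolynomials.
End GroupRing.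

(** * Cluster variables divided by their values in the semifield *)

Section Separation.
Variables (n : nat) (P : groupType) (oplus : P -> P -> P) (F : fieldType) (iota : P -> F).
Hypotheses (sf : semifield_ax oplus) (gre : group_ring_embedding iota).
Let mu := @mu n P F oplus iota.

Lemma exchE (s : seed n P F) j :
  exch oplus iota s j =
    iota (sy s j) / iota (oplus 1%g (sy s j)) * mon (sx s) (fun i => signed_part true (sB s i j))
    + (iota (oplus 1%g (sy s j)))^-1 * mon (sx s) (fun i => signed_part false (sB s i j)).
Proof.
rewrite /exch (greM gre) (iotaV gre); congr (_ * _ + _ * _).
  rewrite big_mkcond /=; apply: eq_bigr => i _; case: ifPn => H.
    by congr (_ ^+ _); rewrite /signed_part; lia.
  by rewrite (_ : signed_part _ _ = 0%N) // /signed_part; lia.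
rewrite big_mkcond /=; apply: eq_bigr => i _; case: ifPn => H.
  by congr (_ ^+ _); rewrite /signed_part; lia.
by rewrite (_ : signed_part _ _ = 0%N) // /signed_part; lia.
Qed.

Section Step.
Variable m : nat.

(* A seed over [P] written, as in the separation formula, as a quotient [X / g]
   of cluster variables of a pattern with frozen variables by their values in [P]. *)
Record separated (s : seed n P F) (B : 'M[int]_(n + m, n))
    (X : 'I_(n + m) -> F) (g : 'I_(n + m) -> P) : Prop := {
  sep_B : usubmx B = sB s;
  sep_x : forall i, X (lshift m i) = sx s i * iota (g (lshift m i));
  sep_frozen : forall i, X (rshift n i) = iota (g (rshift n i));
  sep_y : forall j,
    iota (sy s j) * mon (fun i => iota (g i)) (fun i => signed_part false (B i j)) =
    mon (fun i => iota (g i)) (fun i => signed_part true (B i j))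
}.

Lemma separated_emon s B X g sgn j : separated s B X g ->
  emon B sgn j X = mon (sx s) (fun i => signed_part sgn (sB s i j))
    * mon (fun i => iota (g i)) (fun i => signed_part sgn (B i j)).
Proof.
move=> sep; rewrite emonE /mon !big_split_ord /= mulrA -big_split /=.
congr (_ * _); apply: eq_bigr => i _; last by rewrite (sep_frozen sep).
by rewrite (sep_x sep) exprMn -(sep_B sep) mxE.
Qed.

(** The values [g] mutate by the exchange relation with [oplus] in place of addition. With a and b
    the values of the two monomials, y_k = a / b, so the normalizing factor 1 / (1 [oplus] y_k) is b
    / (b [oplus] a), exactly what the quotient produces. *)
Lemma separated_mu s B X g k : good_matrix B -> (forall i, sx s i != 0) ->
  separated s B X g ->
  exists g', separated (mu k s) (emut k B) (emu B k X) g'.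
Proof.
move=> gB x0 sep; set lk := lshift m k.
pose G i := iota (g i).
have G0 i : G i != 0 by apply: iota_neq0.
have [a aE] := iota_mon gre g (fun i => signed_part true (B i k)).
have [b bE] := iota_mon gre g (fun i => signed_part false (B i k)).
rewrite -/G in aE bE.
have a0 : iota a != 0 by apply: iota_neq0.
have b0 : iota b != 0 by apply: iota_neq0.
have yk : iota (sy s k) = iota a / iota b by rewrite aE -(sep_y sep k) -bE mulfK.
have ykE : sy s k = (b^-1 * a)%g.
  by apply: (iota_inj gre); rewrite yk (greM gre) (iotaV gre) mulrC.
pose D := iota (oplus b a).
have D0 : D != 0 by apply: iota_neq0.
have D1 : iota (oplus 1%g (sy s k)) = D / iota b.
  by rewrite ykE -[X in oplus X _](mulVg b) -(sf_mulDr sf) (greM gre) (iotaV gre) mulrC.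
pose g' i := if i == lk then (oplus b a * (g lk)^-1)%g else g i.
pose G' i := iota (g' i).
have G'k : G' lk = D / G lk by rewrite /G' /g' eqxx (greM gre) (iotaV gre).
have G'E i : i != lk -> G' i = G i by rewrite /G' /g' => /negPf ->.
have Bkk : B lk k = 0 := good_diag k gB.
have monG' v : mon G' v = (D / G lk) ^+ v lk * mon G (off lk v) by rewrite (mon_off _ G'E) G'k.
have monG v : mon G v = G lk ^+ v lk * mon G (off lk v) by apply: mon_off.
exists g'; split.
- by rewrite usubmx_emut (sep_B sep).
- move=> i; rewrite -/(G' _); have [->|ik] := eqVneq i k; last first.
    by rewrite emu_off ?lshift_eq // (sep_x sep) /= (negPf ik) -/(G _) G'E // /lk lshift_eq.
  rewrite emu_at -/lk G'k /= eqxx exchE /eexch !(separated_emon _ _ sep) -aE -bE.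
  rewrite yk D1 (sep_x sep) -/(G _) -/lk.
  move: (mon (sx s) _) (mon (sx s) _) (sx s k) (x0 k) (G lk) (G0 lk) => u v xk xk0 Gk Gk0.
  by field; rewrite ?D0 ?xk0 ?Gk0 ?b0.
- move=> i; rewrite -/(G' _) emu_off; last by rewrite eq_rlshift.
  by rewrite (sep_frozen sep) G'E // eq_rlshift.
move=> j; rewrite -/G'; have [->|jk] := eqVneq j k.
  rewrite /= eqxx (iotaV gre) yk !monG' emut_row Bkk oppr0 !signed_part0 !expr0 !mul1r.
  have offE s1 : mon G (off lk (fun i => signed_part s1 (emut k B i k)))
      = mon G (fun i => signed_part (~~ s1) (B i k)).
    rewrite [RHS]monG Bkk signed_part0 expr0 mul1r; apply: eq_mon => i.
    by rewrite /off emut_col signed_partN.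
  by rewrite !offE /= -aE -bE invf_div divfK.
rewrite /= (negPf jk) !(greM gre) !(iota_gexpz gre) yk D1.
have Bkj : sB s k j = B lk j by rewrite -(sep_B sep) mxE.
rewrite Bkj !monG' emut_row !signed_partN /=.
have := sep_y sep j; rewrite -/G.
rewrite (monG (fun i => signed_part false (B i j))) (monG (fun i => signed_part true (B i j))).
set p := signed_part true (B lk j); set q := signed_part false (B lk j).
have -> : Num.max (B lk j) 0 = p%:Z by rewrite /p /signed_part; lia.
have -> : - B lk j = q%:Z - p%:Z by rewrite /p /q /signed_part; lia.
have := iota_neq0 gre (sy s j); move: (iota (sy s j)) => Y Y0.
set Mf := mon G (off lk _); set Mt := mon G (off lk _).
set Mf' := mon G (off lk _); set Mt' := mon G (off lk _).
(* The mutation rule for the entries of column [j], in multiplicative form and with the factor at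
   [k] removed. *)
have Mexp : iota a ^+ p * Mt * Mf' = iota b ^+ q * Mf * Mt'.
  rewrite aE bE !monXn !monD; apply: eq_mon => i; rewrite /off.
  have [->|ik] := eqVneq i lk; first by rewrite Bkk !signed_part0 !muln0.
  have := mutation_termE (B i k) (B lk j); rewrite -/p -/q => E1.
  have := signed_part_sub true (emut k B i j); have := signed_part_sub true (B i j).
  rewrite /= [in emut k B i j]emutE // E1.
  by rewrite [(p * _)%N]mulnC [(q * _)%N]mulnC; lia.
have Mt0 : Mt != 0 by apply: mon_neq0.
have Mf0 : Mf != 0 by apply: mon_neq0.
have Mf'0 : Mf' != 0 by apply: mon_neq0.
rewrite expfzDr ?mulf_neq0 ?invr_neq0 // -invr_expz -!exprnP !expr_div_n => Yeq.
have P0 z k' : z != 0 :> F -> z ^+ k' != 0 by apply: expf_neq0.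
have YE : Y = G lk ^+ p * Mt / (G lk ^+ q * Mf).
  by rewrite -Yeq mulfK // mulf_neq0 ?P0.
have Mt'E : Mt' = iota a ^+ p * Mt * Mf' / (iota b ^+ q * Mf).
  by rewrite Mexp [_ * Mt']mulrC mulfK // mulf_neq0 ?P0.
rewrite YE Mt'E.
move: (P0 _ p (G0 lk)) (P0 _ q (G0 lk)) (P0 _ p b0) (P0 _ q b0) (P0 _ p D0) Mf0.
move: (G lk ^+ p) (G lk ^+ q) (iota b ^+ p) (iota b ^+ q) (D ^+ p) (D ^+ q) (iota a ^+ p).
move: Mf Mt Mf' {YE Mt'E Mt0 Mf'0 Yeq Mexp} => Mf Mt Mf' c1 c2 c3 c4 c5 c6 c7 n1 n2 n3 n4 n5 n6.
by field; rewrite n1 n2 n3 n4 n5 n6.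
Qed.

Definition seed_path (s : seed n P F) (ks : seq 'I_n) : seed n P F := foldl (fun s k => mu k s) s ks.

Lemma separated_path ks s B X g : good_matrix B ->
  (forall ks i, sx (seed_path s ks) i != 0) -> separated s B X g ->
  exists g' : 'I_(n + m) -> P,
    (forall i, cvars B X ks (lshift m i) = sx (seed_path s ks) i * iota (g' (lshift m i))) /\
    (forall i, cvars B X ks (rshift n i) = iota (g' (rshift n i))).
Proof.
elim: ks s B X g => [|k ks IH] s B X g gB x0 sep.
  by exists g; split=> i; [apply: (sep_x sep) | apply: (sep_frozen sep)].
have [g1 sep1] := separated_mu k gB (x0 [::]) sep.
exact: (IH _ _ _ _ (good_emut k gB) (fun ks => x0 (k :: ks)) sep1).
Qed.

End Step.

(** * Principal coefficients and Laurent polynomials over the group ring *)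

Section PrincipalExtension.
Variable s : seed n P F.
Hypotheses (sB_tsss : totally_sign_skew_symmetric (sB s)).
Hypothesis sx_neq0 : forall ks i, sx (seed_path s ks) i != 0.

Definition principal_matrix : 'M[int]_(n + n, n) := col_mx (sB s) 1%:M.

Definition principal_vars (i : 'I_(n + n)) : F :=
  match split i with inl j => sx s j | inr j => iota (sy s j) end.

Lemma principal_varsl i : principal_vars (lshift n i) = sx s i.
Proof. by rewrite /principal_vars; have /= -> := unsplitK (inl i : 'I_n + 'I_n)%type. Qed.

Lemma principal_varsr i : principal_vars (rshift n i) = iota (sy s i).
Proof. by rewrite /principal_vars; have /= -> := unsplitK (inr i : 'I_n + 'I_n)%type. Qed.

(** The identity block alone makes the columns independent. *)
Lemma principal_good : good_matrix principal_matrix.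
Proof.
split; last by rewrite col_mxKu.
move=> w Hw j; have := Hw (rshift n j); rewrite (bigD1 j) //= col_mxEd mxE eqxx mul1r.
rewrite big1 ?addr0 // => i ij; rewrite col_mxEd mxE eq_sym (negPf ij).
by rewrite mul0r.
Qed.

Lemma principal_separated :
  exists g, separated s principal_matrix principal_vars g.
Proof.
pose g (i : 'I_(n + n)) := match split i with inl _ => 1%g | inr j => sy s j end.
have gl i : g (lshift n i) = 1%g.
  by rewrite /g; have /= -> := unsplitK (inl i : 'I_n + 'I_n)%type.
have gr i : g (rshift n i) = sy s i.
  by rewrite /g; have /= -> := unsplitK (inr i : 'I_n + 'I_n)%type.
exists g; split.
- by rewrite col_mxKu.
- by move=> i; rewrite principal_varsl gl (gre1 gre) mulr1.
- by move=> i; rewrite principal_varsr gr.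
move=> j; have monE sgn : mon (fun i => iota (g i)) (fun i => signed_part sgn (principal_matrix i j))
    = iota (sy s j) ^+ signed_part sgn 1.
  rewrite /mon big_split_ord /= big1 ?mul1r => [|i _]; last by rewrite gl (gre1 gre) expr1n.
  rewrite (bigD1 j) //= gr col_mxEd mxE eqxx big1 ?mulr1 // => i ij.
  by rewrite col_mxEd mxE (negPf ij) signed_part0 expr0.
by rewrite !monE /signed_part /= expr1 expr0 mulr1.
Qed.

(** The integer Laurent polynomial of the principal pattern is specialized at frozen variables equal
    to the coefficients. These are units of the group ring, so only a monomial in the cluster
    remains as denominator. *)
Theorem ZP_laurent ks i : exists (q : {mpoly F[n]}) (d : 'X_{1..n}),
  ZP_mpoly iota q /\ sx (seed_path s ks) i * ('X_[d]).@[sx s] = q.@[sx s].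
Proof.
have [g0 sep0] := principal_separated.
have path ks' := separated_path ks' principal_good sx_neq0 sep0.
(* At this point the variables of the extended pattern are cluster variables times elements of [P],
   or elements of [P], hence nonzero. *)
have nv : nonvanishing principal_matrix principal_vars.
  move=> ks' l; have [g [gl gr]] := path ks'.
  have := splitK l; case: (split l) => i' <- /=; first by rewrite gl mulf_neq0 // iota_neq0.
  by rewrite gr iota_neq0.
have [q [d qd]] := laurent_cvars ks (lshift n i) principal_good.
have {qd} := qd F principal_vars nv; have [g [-> _]] := path ks.
pose h (l : 'I_(n + n)) : {mpoly F[n]} :=
  match split l with inl j => 'X_j | inr j => (iota (sy s j))%:MP end.
have hl j : h (lshift n j) = 'X_j.
  by rewrite /h; have /= -> := unsplitK (inl j : 'I_n + 'I_n)%type.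
have hr j : h (rshift n j) = (iota (sy s j))%:MP.
  by rewrite /h; have /= -> := unsplitK (inr j : 'I_n + 'I_n)%type.
have ZPh l : ZP_mpoly iota (h l).
  have := splitK l; case: (split l) => j <- /=; first by rewrite hl; apply: ZP_mpolyX.
  by rewrite hr; apply: ZP_mpolyC => //; apply: in_ZP_iota.
have evh (p : {mpoly int[n + n]}) : (mmap intr h p).@[sx s] = ev principal_vars p.
  rewrite /mmap /ev /mmap raddf_sum /=; apply: eq_bigr => m _.
  rewrite mevalM -(rmorph_int (@mpolyC n F)) mevalC; congr (_ * _).
  rewrite rmorph_prod /=; apply: eq_bigr => l _; rewrite rmorphXn /=; congr (_ ^+ _).
  have := splitK l; case: (split l) => j <- /=.
    by rewrite hl principal_varsl mevalXU.
  by rewrite hr principal_varsr mevalC.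
have ZPev (p : {mpoly int[n + n]}) : ZP_mpoly iota (mmap intr h p).
  rewrite /mmap; apply: (big_ind (@ZP_mpoly n P F iota)) => [||m _].
  - by move=> m; rewrite mcoeff0; apply: in_ZP0.
  - exact: ZP_mpolyD.
  apply: ZP_mpolyM => //; first by rewrite -(rmorph_int (@mpolyC n F)); apply/ZP_mpolyC/in_ZP_int.
  apply: (big_ind (@ZP_mpoly n P F iota)) => [||l _].
  - by rewrite -mpolyX0; apply: ZP_mpolyX.
  - exact: ZP_mpolyM.
  by apply: ZP_mpolyXn.
have [c cE] := iota_mon gre (sy s) (fun j => d (rshift n j)).
have dE : ev principal_vars 'X_[d] = ('X_[[multinom d (lshift n j) | j < n]]).@[sx s] * iota c.
  rewrite evX big_split_ord mevalX cE; congr (_ * _); apply: eq_bigr => j _.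
    by rewrite principal_varsl mnmE.
  by rewrite principal_varsr.
rewrite dE -evh => E1.
exists (iota (g (lshift n i) * c)^-1%g *: mmap intr h q), [multinom d (lshift n j) | j < n].
split; first by apply: ZP_mpolyZ => //; apply: in_ZP_iota.
rewrite mevalZ -E1 (iotaV gre) (greM gre).
have := iota_neq0 gre c; have := iota_neq0 gre (g (lshift n i)).
move: (iota (g _)) (iota c) (_.@[_]) (sx _ _) => u v z t u0 v0.
by field; rewrite u0 v0.
Qed.

End PrincipalExtension.
End Separation.

(** * Clusters determine exchange polynomials *)

Section MonomialFactors.
Variables (n : nat) (F : fieldType).
Implicit Types (p q : {mpoly F[n]}) (e : 'X_{1..n}).

Definition kill_var (i : 'I_n) (l : 'I_n) : {mpoly F[n]} := if l == i then 0 else 'X_l.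

Definition at_zero i p : {mpoly F[n]} := mmap (@mpolyC n F) (kill_var i) p.

Lemma at_zeroX i e : at_zero i 'X_[e] = if e i == 0%N then 'X_[e] else 0.
Proof.
rewrite /at_zero mmapX /mmap1 /kill_var; case: eqP => [e0|/eqP e0].
  rewrite [RHS]mpolyXE_id; apply: eq_bigr => l _; case: eqP => // ->.
  by rewrite e0 !expr0.
by rewrite (bigD1 i) //= eqxx expr0n (negPf e0) mul0r.
Qed.

(* ['X_i] is prime: its multiples are the kernel of [at_zero i]. *)
Lemma at_zero_decomp i p : exists p1, p = at_zero i p + 'X_i * p1.
Proof.
elim/mpolyind: p => [|c e p _ _ [p1 IH]].
  by exists 0; rewrite /at_zero mmap0 mulr0 addr0.
have [p2 E] : exists p2, 'X_[e] = at_zero i 'X_[e] + 'X_i * p2.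
  rewrite at_zeroX; case: eqP => [_|/eqP e0]; first by exists 0; rewrite mulr0 addr0.
  by exists 'X_[e - U_(i)]; rewrite add0r -mpolyXD addmC submK // lep1mP.
exists (c *: p2 + p1).
have -> : at_zero i (c *: 'X_[e] + p) = c *: at_zero i 'X_[e] + at_zero i p.
  by rewrite /at_zero mmapD mmapZ mul_mpolyC.
by rewrite {1}IH {1}E scalerDr mulrDr scalerAr addrACA.
Qed.

(** Induction on the degree: a variable dividing the monomial is prime, so it divides [p] or [q] and
    can be cancelled. A factor of 1 is a constant. *)
Lemma monomial_factor p q e : p * q = 'X_[e] -> exists c e', p = c *: 'X_[e'].
Proof.
have [d] := ubnP (mdeg e); elim: d p q e => // d IH p q e ed pq.
have pq0 : p * q != 0 by rewrite pq -msupp_eq0 msuppX.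
have [e0|/eqP e0] := altP (e =P 0%MM).
  move: pq0; rewrite mulf_eq0 negb_or => /andP[p0 q0].
  have := msizeM p0 q0; rewrite pq e0 mpolyX0 msize1 => sz.
  have : (msize p <= 1)%N.
    move: sz p0 q0; rewrite -!msize_poly_eq0; move: (msize p) (msize q) => a b. lia.
  by move/msize1_polyC => ->; exists p@_0, 0%MM; rewrite mpolyX0 -alg_mpolyC.
have [i ei] : exists i, e i != 0%N.
  apply/existsP; apply: contra_notT e0; rewrite negb_exists => /forallP H.
  by apply/mnmP => i; rewrite mnm0E; have := H i; rewrite negbK => /eqP.
have eE : 'X_[e] = 'X_i * 'X_[e - U_(i)] :> {mpoly F[n]}.
  by rewrite -mpolyXD addmC submK // lep1mP.
have Xi0 : 'X_i != 0 :> {mpoly F[n]} by rewrite -msupp_eq0 msuppX.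
have de : (mdeg (e - U_(i)) < d)%N.
  have : mdeg e = (mdeg (e - U_(i)) + 1)%N.
    by rewrite -{1}(@submK _ U_(i)%MM e) ?lep1mP // mdegD mdeg1.
  by lia.
have := congr1 (at_zero i) pq; rewrite at_zeroX (negPf ei) /at_zero rmorphM /= => /eqP.
rewrite mulf_eq0 => /orP[] /eqP z0.
  have [p1 pE] := at_zero_decomp i p; rewrite {1}/at_zero z0 add0r in pE.
  have [|c [e' p1E]] := IH p1 q _ de.
    by apply: (mulfI Xi0); rewrite -eE -pq pE mulrA.
  by exists c, (U_(i) + e')%MM; rewrite pE p1E -scalerAr mpolyXD.
have [q1 qE] := at_zero_decomp i q; rewrite {1}/at_zero z0 add0r in qE.
apply: (IH p q1 _ de); apply: (mulfI Xi0); rewrite -eE -pq qE; ring.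
Qed.

Lemma binomial_eq (a1 a2 b1 b2 : 'X_{1..n}) (u1 u2 v1 v2 : F) :
  u1 != 0 -> u2 != 0 -> a1 != a2 ->
  u1 *: 'X_[a1] + u2 *: 'X_[a2] = v1 *: 'X_[b1] + v2 *: 'X_[b2] :> {mpoly F[n]} ->
  [/\ b1 = a1, b2 = a2, u1 = v1 & u2 = v2] \/ [/\ b1 = a2, b2 = a1, u1 = v2 & u2 = v1].
Proof.
move=> u1n u2n a12 E.
have c e : u1 * (a1 == e)%:R + u2 * (a2 == e)%:R = v1 * (b1 == e)%:R + v2 * (b2 == e)%:R.
  by have := congr1 (mcoeff e) E; rewrite !mcoeffD !mcoeffZ !mcoeffX.
have := c a1; have := c a2; rewrite !eqxx (negPf a12) [a2 == a1]eq_sym (negPf a12).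
rewrite !mulr0 !mulr1 addr0 add0r.
have [b1a1|_] := eqVneq b1 a1.
  rewrite b1a1 (negPf a12) mulr0 add0r mulr1.
  have [b2a2|b2a2] := eqVneq b2 a2.
    rewrite b2a2 [a2 == a1]eq_sym (negPf a12) mulr0 mulr1 addr0 => -> ->; by left.
  by rewrite mulr0 => u20; rewrite u20 eqxx in u2n.
rewrite mulr0 add0r.
have [b2a1|_] := eqVneq b2 a1; last by rewrite mulr0 => _ u10; rewrite u10 eqxx in u1n.
rewrite b2a1 (negPf a12) mulr0 mulr1 addr0.
have [b1a2|_] := eqVneq b1 a2; first by rewrite mulr1 => -> ->; right.
by rewrite mulr0 => u20; rewrite u20 eqxx in u2n.
Qed.

End MonomialFactors.

(** * Involutivity of seed mutation and walks in a pattern *)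

Section Seeds.
Variables (n : nat) (P : groupType) (oplus : P -> P -> P) (F : fieldType) (iota : P -> F).
Hypotheses (sf : semifield_ax oplus) (gre : group_ring_embedding iota).
Let mu := @mu n P F oplus iota.
Let walk := @seed_path n P oplus F iota.
Implicit Types (s : seed n P F) (k : 'I_n).

Lemma sf_inv_add (y : P) : iota (oplus 1%g y^-1%g) = iota (oplus 1%g y) / iota y.
Proof.
have -> : oplus 1%g y^-1%g = (y^-1 * oplus 1%g y)%g.
  by rewrite (sf_mulDr sf) mulg1 mulVg (sf_addC sf).
by rewrite (greM gre) (iotaV gre) mulrC.
Qed.

(** Variables are compared only where the column is nonzero, so they may differ at the indices that
    do not enter the exchange polynomial. *)
Lemma exch_same s s' (sigma : 'S_n) j j' :
  sy s' j' = sy s j -> (forall i, sB s' i j' = sB s (sigma i) j) ->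
  (forall i, sB s' i j' != 0 -> sx s' i = sx s (sigma i)) ->
  exch oplus iota s' j' = exch oplus iota s j.
Proof.
move=> Ey EB Ex; rewrite !(exchE oplus gre) Ey.
have E sgn : mon (sx s') (fun i => signed_part sgn (sB s' i j'))
    = mon (sx s) (fun i => signed_part sgn (sB s i j)).
  rewrite /mon [RHS](reindex_inj (@perm_inj _ sigma)); apply: eq_bigr => i _.
  rewrite -EB; have [->|/Ex ->] := eqVneq (sB s' i j') 0; last by [].
  by rewrite signed_part0 !expr0.
by rewrite !E.
Qed.

(** Inverting the coefficient and negating the column exchanges the two terms. As b_kk = 0, this
    covers a seed and its own mutation at [k]. *)
Lemma exch_opposite s s' (sigma : 'S_n) j j' :
  sy s' j' = (sy s j)^-1%g -> (forall i, sB s' i j' = - sB s (sigma i) j) ->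
  (forall i, sB s' i j' != 0 -> sx s' i = sx s (sigma i)) ->
  exch oplus iota s' j' = exch oplus iota s j.
Proof.
move=> Ey EB Ex; rewrite !(exchE oplus gre) Ey sf_inv_add (iotaV gre).
have E sgn : mon (sx s') (fun i => signed_part sgn (sB s' i j'))
    = mon (sx s) (fun i => signed_part (~~ sgn) (sB s i j)).
  rewrite /mon [RHS](reindex_inj (@perm_inj _ sigma)); apply: eq_bigr => i _.
  rewrite -signed_partN -EB; have [->|/Ex ->] := eqVneq (sB s' i j') 0; last by [].
  by rewrite signed_part0 !expr0.
rewrite !E /=; have := iota_neq0 gre (sy s j); have := iota_neq0 gre (oplus 1%g (sy s j)).
move: (iota _) (iota _) (mon _ _) (mon _ _) => a b c d a0 b0.
by field; rewrite a0 b0.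
Qed.

Lemma mutBK k (B : 'M[int]_n) : mutB k (mutB k B) = B.
Proof. by rewrite -(col_mxKu B (0 : 'M_(0, n))) -!usubmx_emut emutK. Qed.

Lemma muK k s : sB s k k = 0 -> sx s k != 0 -> exch oplus iota s k != 0 ->
  mu k (mu k s) = s.
Proof.
move=> Bkk xk0 ek0; case: s Bkk xk0 ek0 => x y B /= Bkk xk0 ek0.
have ex : exch oplus iota (mu k (Seed x y B)) k = exch oplus iota (Seed x y B) k.
  apply: (@exch_opposite _ _ 1%g) => /= [|i|i]; first by rewrite eqxx.
    by rewrite perm1 mxE eqxx orbT.
  rewrite perm1 mxE eqxx orbT; have [->|//] := eqVneq i k.
  by rewrite Bkk oppr0 eqxx.
set s := Seed x y B in ex ek0 *.
have -> : s = Seed (sx s) (sy s) (sB s) by [].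
rewrite {1}/mu /Defs.mu; congr Seed; last exact: mutBK.
- apply: functional_extensionality => i; rewrite ex /=.
  have [->|ik] := eqVneq i k => //.
  by rewrite eqxx invf_div mulrCA divff ?mulr1.
apply: functional_extensionality => i; rewrite /=.
have [->|ik] := eqVneq i k; first by rewrite eqxx invgK.
rewrite eqxx !mxE eqxx /=.
apply: (iota_inj gre); rewrite !(greM gre) !(iota_gexpz gre) sf_inv_add (iotaV gre) opprK.
have := iota_neq0 gre (y k); have := iota_neq0 gre (oplus 1%g (y k)).
move: (iota (y k)) (iota (y i)) (iota (oplus _ _)) (B k i) => a c d b d0 a0.
have [p [q [-> -> ->]]] : exists p q : nat,
    [/\ Num.max b 0 = p%:Z, Num.max (- b) 0 = q%:Z & b = p%:Z - q%:Z].
  by exists (absz (Num.max b 0)), (absz (Num.max (- b) 0)); split; lia.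
rewrite opprB !expfzDr ?mulf_neq0 ?invr_neq0 // -!invr_expz -!exprnP !exprVn !expr_div_n.
have P0 z (e : nat) : z != 0 :> F -> z ^+ e != 0 by apply: expf_neq0.
move: (P0 _ p a0) (P0 _ q a0) (P0 _ p d0) (P0 _ q d0).
move: (a ^+ p) (a ^+ q) (d ^+ p) (d ^+ q) => c1 c2 c3 c4 n1 n2 n3 n4.
by field; rewrite n1 n2 n3 n4.
Qed.

Lemma smu_neq0_exch s k : (forall ks i, sx (walk s ks) i != 0) -> exch oplus iota s k != 0.
Proof.
by move=> s0; have := s0 [:: k] k; rewrite /= eqxx mulf_eq0 negb_or => /andP[].
Qed.

Section Pattern.
Variable S : seq 'I_n -> seed n P F.
Hypothesis patS : cluster_pattern oplus iota S.

Lemma alg_indep_neq0 (x : 'I_n -> F) i : alg_indep iota x -> x i != 0.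
Proof.
move=> xi; apply/eqP => x0.
have /eqP : 'X_i = 0 :> {mpoly F[n]}.
  by apply: xi; [exact: (ZP_mpolyX gre) | rewrite mevalXU].
by rewrite -msupp_eq0 msuppX.
Qed.

Lemma pattern_alg_indep w : reduced w -> alg_indep iota (sx (S w)).
Proof. by move=> rw; case: (patS.1 w rw) => [[]]. Qed.

Lemma pattern_tsss w : reduced w -> totally_sign_skew_symmetric (sB (S w)).
Proof. by move=> rw; case: (patS.1 w rw). Qed.

Lemma reduced_rconsl w k : reduced (rcons w k) -> reduced w.
Proof. by case: w => // l w; rewrite /reduced /= rcons_path => /andP[]. Qed.

Lemma tsss_diag (B : 'M[int]_n) k : totally_sign_skew_symmetric B -> B k k = 0.
Proof. by move=> /(_ [::] k k) /= []; [nia | case]. Qed.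

Lemma pattern_back w k : reduced (rcons w k) -> mu k (S (rcons w k)) = S w.
Proof.
move=> rwk; have rw := reduced_rconsl rwk; have Ewk := patS.2 _ _ rwk.
have := alg_indep_neq0 k (pattern_alg_indep rwk); rewrite Ewk /= eqxx mulf_eq0 negb_or.
move=> /andP[ek _]; apply: muK => //; first exact/tsss_diag/pattern_tsss.
exact/alg_indep_neq0/pattern_alg_indep.
Qed.

(** A letter that makes the word non-reduced only goes back along the last edge, and mutation is an
    involution. *)
Lemma pattern_smu ks w : reduced w -> exists2 w', reduced w' & walk (S w) ks = S w'.
Proof.
elim: ks w => [|k ks IH] w rw; first by exists w.
suff [w1 rw1 E1] : exists2 w1, reduced w1 & mu k (S w) = S w1.
  by have [w' rw' E'] := IH w1 rw1; exists w' => //; rewrite -E' -E1.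
case/lastP: w rw => [|u l] rw; first by exists [:: k] => //; apply/esym/(patS.2 [::] k).
have [lk|lk] := eqVneq l k.
  by exists u; [exact: reduced_rconsl rw | rewrite -lk pattern_back].
have rk : reduced (rcons (rcons u l) k).
  case: u rw => [|l0 u] rw; first by rewrite /reduced /= lk.
  by rewrite /reduced /= rcons_path; apply/andP; split; [exact: rw | rewrite last_rcons].
by exists (rcons (rcons u l) k) => //; rewrite (patS.2 _ _ rk).
Qed.

(** The walk goes from [t1] back to the root and from there out to [t2]. *)
Lemma pattern_connected t1 t2 : reduced t1 -> reduced t2 ->
  exists ks, S t2 = walk (S t1) ks.
Proof.
move=> r1 r2; exists (rev t1 ++ t2).
rewrite /walk /seed_path foldl_cat.
have -> : foldl (fun s k => mu k s) (S t1) (rev t1) = S [::].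
  elim/last_ind: t1 r1 => // u k IH r1; rewrite rev_rcons /= pattern_back //.
  exact: IH (reduced_rconsl r1).
elim/last_ind: t2 r2 => // u k IH r2.
by rewrite foldl_rcons -IH ?(patS.2 _ _ r2) //; exact: reduced_rconsl r2.
Qed.

End Pattern.

(** * Exchange binomials as polynomials and their comparison *)

Definition binom (y : P) (v : 'I_n -> int) : {mpoly F[n]} :=
  (iota y / iota (oplus 1%g y)) *: 'X_[mvec (fun i => signed_part true (v i))]
  + (iota (oplus 1%g y))^-1 *: 'X_[mvec (fun i => signed_part false (v i))].

Lemma meval_mvec (x : 'I_n -> F) v : ('X_[mvec v]).@[x] = mon x v.
Proof. by rewrite mevalX; apply: eq_bigr => i _; rewrite mnmE. Qed.

Lemma meval_binom s (sigma : 'S_n) (x : 'I_n -> F) j v :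
  (forall i, sB s i j = v (sigma i)) ->
  (forall i, sB s i j != 0 -> sx s i = x (sigma i)) ->
  (binom (sy s j) v).@[x] = exch oplus iota s j.
Proof.
move=> Ev Ex; rewrite (exchE oplus gre) /binom mevalD !mevalZ !meval_mvec.
have E sgn : mon x (fun i => signed_part sgn (v i))
    = mon (sx s) (fun i => signed_part sgn (sB s i j)).
  rewrite /mon (reindex_inj (@perm_inj _ sigma)); apply: eq_bigr => i _.
  rewrite -Ev; have [->|/Ex ->] := eqVneq (sB s i j) 0; last by [].
  by rewrite signed_part0 !expr0.
by rewrite !E.
Qed.

Lemma ZP_binom y v : ZP_mpoly iota (binom y v).
Proof.
rewrite /binom; apply: ZP_mpolyD; apply: (ZP_mpolyZ gre); try exact: (ZP_mpolyX gre).
  by rewrite -(iotaV gre) -(greM gre); apply: in_ZP_iota.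
by rewrite -(iotaV gre); apply: in_ZP_iota.
Qed.

(** Stated for all walks, so that it passes to every mutated seed without reference to the tree. *)
Definition regular_seed s := forall ks,
  alg_indep iota (sx (walk s ks)) /\ totally_sign_skew_symmetric (sB (walk s ks)).

Lemma regular_seed_neq0 s : regular_seed s -> forall ks i, sx (walk s ks) i != 0.
Proof. by move=> rs ks i; apply: alg_indep_neq0 (rs ks).1. Qed.

(* Both [exch s2 k / exch s1 (sigma k)] and its inverse are Laurent: the mutation
   of [s2] at [k] is a Laurent polynomial in the mutation of [s1] at [sigma k]. *)
Lemma exch_divides s1 s2 (sigma : 'S_n) k ks :
  regular_seed s1 -> walk s1 ks = s2 ->
  (forall i, sx s2 i = sx s1 (sigma i)) ->
  exists e q, binom (sy s2 k) (fun i => sB s2 ((sigma^-1)%g i) k) * 'X_[e]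
    = binom (sy s1 (sigma k)) (fun i => sB s1 i (sigma k)) * q.
Proof.
move=> rs1 E12 x12; set A := binom _ _; set B := binom _ _.
set k1 := sigma k; pose s1' := mu k1 s1.
have s10 := regular_seed_neq0 rs1.
have B1kk : sB s1 k1 k1 = 0 by apply/tsss_diag/(rs1 [::]).2.
have B2kk : sB s2 k k = 0 by rewrite -E12; apply/tsss_diag/(rs1 ks).2.
have e1 := smu_neq0_exch k1 s10.
have s1E : mu k1 s1' = s1 by apply: muK => //; apply: (s10 [::]).
(* From the mutated seed the word returns to [s1], continues to [s2] and mutates there at [k]. *)
pose ks' := k1 :: rcons ks k.
have E' : walk s1' ks' = mu k s2.
  by rewrite /walk /seed_path /= foldl_rcons -E12 -[in RHS]s1E.
have [q [d [ZPq Eq]]] := ZP_laurent sf gre (rs1 [:: k1]).2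
  (fun ks => s10 (k1 :: ks)) ks' k.
have x1' i : i != k1 -> sx s1' i = sx s1 i by move=> /negPf ik; rewrite /= ik.
have xk1 : sx s1' k1 = exch oplus iota s1 k1 / sx s1 k1 by rewrite /= eqxx.
have x0 := s10 [::] k1.
(* As diagonal entries vanish, neither binomial contains the variable [k1], the only one in which
   [s1'] differs from [s1]. *)
have EA : A.@[sx s1'] = exch oplus iota s2 k.
  apply: (meval_binom (sigma := sigma)) => i; first by rewrite permK.
  move=> Bik; rewrite x12 x1' //; apply: contraNneq Bik => /perm_inj ->.
  by rewrite B2kk.
have EB : B.@[sx s1'] = exch oplus iota s1 k1.
  apply: (meval_binom (sigma := 1%g)) => i; first by rewrite perm1.
  by move=> Bik; rewrite perm1 x1' //; apply: contraNneq Bik => ->; rewrite B1kk.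
(* The extra [U_(k1)] comes from x_k of [s2], which is x_k1 of [s1], that is F_k1 divided by the
   [k1]-th variable of [s1']. *)
exists (U_(k1) + d)%MM, q; apply/eqP; rewrite -subr_eq0; apply/eqP.
apply: (rs1 [:: k1]).1.
  apply: ZP_mpolyD; first by apply: (ZP_mpolyM gre); [exact: ZP_binom | exact: (ZP_mpolyX gre)].
  by apply/(ZP_mpolyN gre)/(ZP_mpolyM gre) => //; apply: ZP_binom.
have {}Eq : sx (mu k s2) k * ('X_[d]).@[sx s1'] = q.@[sx s1'] by rewrite -E'.
rewrite -/s1' mevalB !mevalM EA EB mpolyXD mevalM mevalXU -Eq xk1 /= eqxx x12 -/k1.
by field.
Qed.

(** An isolated index stays isolated. Its coefficient can only be inverted, which leaves F_k
    unchanged, so x_k alternates between two values. *)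
Lemma zero_column_path s k ks : regular_seed s -> (forall i, sB s i k = 0) ->
  [/\ forall i, sB (walk s ks) i k = 0,
      sy (walk s ks) k = sy s k \/ sy (walk s ks) k = (sy s k)^-1%g &
      sx (walk s ks) k = sx s k \/ sx (walk s ks) k * sx s k = exch oplus iota s k].
Proof.
move=> rs B0; have s0 := regular_seed_neq0 rs.
elim/last_ind: ks => [|ks l [Bc yc xc]]; first by split; [|left|left].
have -> : walk s (rcons ks l) = mu l (walk s ks) by rewrite /walk /seed_path foldl_rcons.
have ec : exch oplus iota (walk s ks) k = exch oplus iota s k.
  case: yc => yc.
    by apply: (exch_same (sigma := 1%g)) => // i; rewrite Bc ?B0 ?eqxx.
  by apply: (exch_opposite (sigma := 1%g)) => // i; rewrite Bc ?B0 ?oppr0 ?eqxx.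
have cl i : sB (mu l (walk s ks)) i k = 0.
  by rewrite mxE !Bc oppr0 mulr0 maxxx mulr0 addr0 if_same.
split=> //=.
  have [kl|kl] := eqVneq k l; last by rewrite Bc oppr0 maxxx /= !expg0 !mulg1.
  by rewrite -kl; case: yc => ->; [right | left; rewrite invgK].
have [kl|kl] := eqVneq k l; last by [].
rewrite -kl ec; case: xc => xc; first by right; rewrite xc divfK // (s0 [::]).
have xk0 := s0 ks k; left; rewrite -xc mulrC mulKf //.
Qed.

Definition rename (sigma : 'S_n) (p : {mpoly F[n]}) : {mpoly F[n]} :=
  mmap (@mpolyC n F) (fun i => 'X_(sigma i)) p.

Lemma rename_mvec sigma u : rename sigma 'X_[mvec u] = 'X_[mvec (fun i => u ((sigma^-1)%g i))].
Proof.
rewrite /rename mmapX /mmap1 [RHS]mpolyXE_id [RHS](reindex_inj (@perm_inj _ sigma)) /=.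
by apply: eq_bigr => i _; rewrite !mnmE permK.
Qed.

Lemma renameX sigma e : exists e', rename sigma 'X_[e] = 'X_[e'].
Proof.
exists (mvec (fun i => e ((sigma^-1)%g i))); rewrite -rename_mvec; congr (rename _ 'X_[_]).
by apply/mnmP => i; rewrite mnmE.
Qed.

Lemma rename_binom sigma y v :
  rename sigma (binom y v) = binom y (fun i => v ((sigma^-1)%g i)).
Proof.
rewrite /rename /binom mmapD !mmapZ -!/(rename _ _) !rename_mvec.
by rewrite !mul_mpolyC.
Qed.

Lemma eq_binom y v w : v =1 w -> binom y v = binom y w.
Proof.
move=> vw; have E sgn : mvec (fun i => signed_part sgn (v i)) = mvec (fun i => signed_part sgn (w i)).
  by apply/mnmP => i; rewrite !mnmE vw.
by rewrite /binom !E.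
Qed.

Lemma mvec_inj (u u' : 'I_n -> nat) : mvec u = mvec u' -> u =1 u'.
Proof. by move=> E i; have := congr1 (fun e : 'X_{1..n} => e i) E; rewrite !mnmE. Qed.

Lemma mvec_signed_part_eq (v : 'I_n -> int) :
  mvec (fun i => signed_part true (v i)) = mvec (fun i => signed_part false (v i)) ->
  forall i, v i = 0.
Proof. by move=> /mvec_inj H i; have := H i; rewrite /signed_part /=; lia. Qed.

Lemma mvec_shift_signed (e e' : 'X_{1..n}) (v w : 'I_n -> int) sg :
  (mvec (fun i => signed_part true (v i)) + e)%MM
    = (mvec (fun i => signed_part sg (w i)) + e')%MM ->
  (mvec (fun i => signed_part false (v i)) + e)%MM
    = (mvec (fun i => signed_part (~~ sg) (w i)) + e')%MM ->
  forall i, v i = if sg then w i else - w i.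
Proof.
move=> E1 E2 i; move: (congr1 (fun d : 'X_{1..n} => d i) E1).
move: (congr1 (fun d : 'X_{1..n} => d i) E2); rewrite !mnmDE !mnmE.
have := signed_part_sub true (v i); have /= := signed_part_sub sg (w i).
by case: (sg) => /=; move: (e i) (e' i); lia.
Qed.

(** The difference of the two exponents is insensitive to the monomial shifts, and the ratio of the
    two coefficients to the scalar [c]; they recover the column up to sign and the coefficient up to
    inversion. *)
Lemma proportional_binom y z v w (c : F) e e' :
  binom y v * 'X_[e] = c *: (binom z w * 'X_[e']) ->
  c != 0 ->
  [\/ [/\ y = z & v =1 w], [/\ y = z^-1%g & forall i, v i = - w i]
    | (forall i, v i = 0) /\ (forall i, w i = 0)].
Proof.
move=> E c0; pose a1 := (mvec (fun i => signed_part true (v i)) + e)%MM.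
pose a2 := (mvec (fun i => signed_part false (v i)) + e)%MM.
pose b1 := (mvec (fun i => signed_part true (w i)) + e')%MM.
pose b2 := (mvec (fun i => signed_part false (w i)) + e')%MM.
pose cf t := (iota (oplus 1%g t))^-1.
have cf0 t : cf t != 0 by rewrite invr_neq0 ?(iota_neq0 gre).
have cfy t : iota t * cf t != 0 by rewrite mulf_neq0 ?(iota_neq0 gre).
have {}E : (iota y * cf y) *: 'X_[a1] + cf y *: 'X_[a2]
    = (c * (iota z * cf z)) *: 'X_[b1] + (c * cf z) *: 'X_[b2] :> {mpoly F[n]}.
  by move: E; rewrite /binom !mulrDl -!scalerAl -!mpolyXD scalerDr !scalerA.
(* If the two monomials on one side coincide, they must coincide on the other side as well, and both
   columns are zero. *)
have [a12|a12] := eqVneq a1 a2.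
  have v0 := mvec_signed_part_eq (addIm a12); have [b12|b12] := eqVneq b1 b2.
    by apply: Or33; split=> //; apply: mvec_signed_part_eq (addIm b12).
  by have [[E1 E2]|[E1 E2]] := binomial_eq (mulf_neq0 c0 (cfy z)) (mulf_neq0 c0 (cf0 z)) b12 (esym E);
    rewrite -E1 -E2 a12 eqxx in b12.
have [[E1 E2 E3 E4]|[E1 E2 E3 E4]] := binomial_eq (cfy y) (cf0 y) a12 E.
  apply: Or31; split; last exact: (mvec_shift_signed (esym E1) (esym E2)).
  apply: (iota_inj gre); apply: (mulIf (cf0 y)); rewrite E3 E4; ring.
apply: Or32; split; last exact: (mvec_shift_signed (esym E2) (esym E1)).
apply: (iota_inj gre); apply: (mulIf (cf0 y)); rewrite E3 E4 (iotaV gre).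
have z0 := iota_neq0 gre z; by field.
Qed.

(** Each exchange binomial divides the other up to a monomial, so they are proportional up to a
    monomial; isolated indices are treated separately. *)
Lemma column_same_or_opposite s1 s2 (sigma : 'S_n) ks ks' k :
  regular_seed s1 -> regular_seed s2 -> walk s1 ks = s2 -> walk s2 ks' = s1 ->
  (forall i, sx s2 i = sx s1 (sigma i)) ->
  (sy s2 k = sy s1 (sigma k) /\ forall i, sB s2 i k = sB s1 (sigma i) (sigma k)) \/
  (sy s2 k = (sy s1 (sigma k))^-1%g /\ forall i, sB s2 i k = - sB s1 (sigma i) (sigma k)).
Proof.
move=> rs1 rs2 E12 E21 x12.
have x21 i : sx s1 i = sx s2 ((sigma^-1)%g i) by rewrite x12 permKV.
have [e [q Eq]] := exch_divides k rs1 E12 x12.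
have [e2 [q2 Eq2]] := exch_divides (sigma k) rs2 E21 x21.
rewrite permK in Eq2.
set A := binom (sy s2 k) _ in Eq; set B := binom (sy s1 (sigma k)) _ in Eq.
(* The second divisibility is written in variables indexed along [s2]; renaming by [sigma] brings it
   to the indexing of [s1]. *)
have rB : rename sigma (binom (sy s1 (sigma k)) (fun i => sB s1 (((sigma^-1)^-1)%g i) (sigma k))) = B.
  by rewrite rename_binom; apply: eq_binom => i; rewrite invgK permKV.
have {Eq2} : B * rename sigma 'X_[e2] = A * rename sigma q2.
  have <- : rename sigma (binom (sy s2 k) (fun i => sB s2 i k)) = A by rewrite rename_binom.
  by rewrite -rB /rename -!rmorphM Eq2.
have [e3 ->] := renameX sigma e2; move: (rename _ q2) => {}q2 Eq2.
have A0 : A != 0.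
  apply: contraTneq (smu_neq0_exch k (regular_seed_neq0 rs2)) => A0.
  rewrite -(@meval_binom s2 sigma (fun i => sx s2 ((sigma^-1)%g i)) k (fun i => sB s2 ((sigma^-1)%g i) k)).
  - by rewrite -/A A0 meval0 eqxx.
  - by move=> i; rewrite permK.
  by move=> i _; rewrite permK.
(* Composing the two divisibilities and cancelling [A] makes the product of the cofactors a
   monomial, so each cofactor is one up to a scalar. *)
have qq2 : q * q2 = 'X_[e + e3].
  apply: (mulfI A0); transitivity (B * 'X_[e3] * q); first by rewrite Eq2; ring.
  by rewrite mpolyXD [RHS]mulrA Eq; ring.
have [c [e' qE]] := monomial_factor qq2.
have c0 : c != 0.
  apply/eqP => c0; have : 'X_[e + e3] != 0 :> {mpoly F[n]} by rewrite -msupp_eq0 msuppX.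
  by rewrite -qq2 qE c0 scale0r mul0r eqxx.
rewrite qE -scalerAr in Eq.
have [[yz vw]|[yz vw]|[v0 w0]] := proportional_binom Eq c0.
- by left; split=> // i; rewrite -vw permK.
- by right; split=> // i; rewrite -vw permK.
have B2 i : sB s2 i k = 0 by have := v0 (sigma i); rewrite permK.
have [Bc yc xc] := zero_column_path ks rs1 w0; rewrite E12 in Bc yc xc.
(* Both columns are zero here. Once [sigma] fixes [sigma k] it fixes [k], and the two coefficients
   then belong to the same isolated index. *)
suff sk : sigma (sigma k) = sigma k.
  have /perm_inj kk := sk; rewrite kk in w0 yc *.
  by case: yc => ->; [left | right]; split=> // i; rewrite B2 w0 ?oppr0.
rewrite x12 in xc; set k1 := sigma k in xc *.
have ind1 := (rs1 [::]).1; rewrite /= in ind1.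
case: xc => xc.
  have : 'X_(sigma k1) - 'X_k1 = 0 :> {mpoly F[n]}.
    apply: ind1; last by rewrite mevalB !mevalXU xc subrr.
    by apply: ZP_mpolyD; [|apply: (ZP_mpolyN gre)]; exact: (ZP_mpolyX gre).
  move=> /(congr1 (mcoeff U_(k1))); rewrite mcoeffB !mcoeffX eqxx mcoeff0 eq_mnm1.
  by case: eqP => // _ /eqP; rewrite sub0r oppr_eq0 oner_eq0.
have mon1 sgn : mon (sx s1) (fun i => signed_part sgn (sB s1 i k1)) = 1.
  by rewrite /mon big1 // => i _; rewrite w0 signed_part0 expr0.
have ZPe : in_ZP iota (exch oplus iota s1 k1).
  rewrite (exchE oplus gre) !mon1 !mulr1 -(iotaV gre) -(greM gre).
  by apply: in_ZPD; apply: in_ZP_iota.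
(* The second value of the isolated variable would make a product of two variables of one cluster an
   element of the group ring, against algebraic independence. *)
have : 'X_(sigma k1) * 'X_k1 - (exch oplus iota s1 k1)%:MP = 0 :> {mpoly F[n]}.
  apply: ind1; last by rewrite mevalB mevalM !mevalXU mevalC xc subrr.
  apply: ZP_mpolyD; first by apply: (ZP_mpolyM gre); exact: (ZP_mpolyX gre).
  exact/(ZP_mpolyN gre)/(ZP_mpolyC gre).
move=> /(congr1 (mcoeff (U_(sigma k1) + U_(k1)))).
rewrite -mpolyXD mcoeffB mcoeffX eqxx mcoeffC mcoeff0 -mdeg_eq0 mdegD !mdeg1 mulr0 subr0.
by move=> /eqP; rewrite oner_eq0.
Qed.

End Seeds.

Theorem theorem3p2 (n : nat) (P : groupType) (oplus : P -> P -> P)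
  (F : fieldType) (iota : P -> F) :
  semifield_ax oplus ->
  group_ring_embedding iota ->
  rational_function_field n iota ->
  forall S : seq 'I_n -> seed n P F,
  cluster_pattern oplus iota S ->
  forall t1 t2 : seq 'I_n, reduced t1 -> reduced t2 ->
  forall sigma : 'S_n,
  (forall i, sx (S t2) i = sx (S t1) (sigma i)) ->
  (forall k : 'I_n,
     (sy (S t2) k = sy (S t1) (sigma k) /\
      forall i, sB (S t2) i k = sB (S t1) (sigma i) (sigma k))
   \/
     (sy (S t2) k = ((sy (S t1) (sigma k))^-1)%g /\
      forall i, sB (S t2) i k = - sB (S t1) (sigma i) (sigma k)))
  /\
  (forall k : 'I_n, exch oplus iota (S t2) k = exch oplus iota (S t1) (sigma k)).
Proof.
move=> sf gre _ S patS t1 t2 r1 r2 sigma x12.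
(* Every seed on a walk from a vertex is again attached to a vertex, so the conditions on seeds hold
   along the whole walk. *)
have reg t : reduced t -> regular_seed oplus iota (S t).
  move=> rt ks; have [w rw ->] := pattern_smu sf gre patS ks rt.
  by split; [exact: (pattern_alg_indep patS) | exact: (pattern_tsss patS)].
have [ks E12] := pattern_connected sf gre patS r1 r2.
have [ks' E21] := pattern_connected sf gre patS r2 r1.
have cols k := column_same_or_opposite sf gre k (reg _ r1) (reg _ r2) (esym E12) (esym E21) x12.
split=> // k; case: (cols k) => -[Ey EB].
  exact: (exch_same oplus gre Ey EB (fun i _ => x12 i)).
exact: (exch_opposite sf gre Ey EB (fun i _ => x12 i)).
Qed.
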